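(* Let $x_0$ be the unique maximum point of the function $x\mapsto \mathcal{H}_2(1-2x)+\mathcal{H}_2(x)$ on $[1/4,1/2]$. Let $\rho_0\approx 0.32$ be the value of $\rho$ in the solution $(\theta_1,\rho)$, with $\theta_1\in[x_0,1/2]$ and $\rho\in[1/4,1/2]$, of the system $$\mathcal{H}_4(\rho)=\mathcal{H}_2(\theta_1)+\mathcal{H}_2(1-2\theta_1),\qquad \mathcal{H}_4(1-2\rho)=1+\mathcal{H}_2(1-2\theta_1).$$ Then for every positive integer $n$ and every set $A\subset C_8^n$ without non-trivial three-term progressions, $$|A|\leqslant \left(2\cdot 2^{\mathcal{H}_4(\rho_0)}\right)^n,$$ where $2\cdot 2^{\mathcal{H}_4(\rho_0)}\approx 7.0899$. In particular, for every positive integer $n$, $$r_3(C_8^n)\leqslant (7.09)^n.$$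
   Context: $C_m$ denotes the cyclic group of order $m$. A non-trivial three-term progression in a finite group $G$ (written multiplicatively) is an ordered triple $(a,b,c)\in G^3$ of mutually distinct elements such that $ac=b^2$. A subset $A\subset G$ is without non-trivial three-term progressions if no such triple has all of $a,b,c\in A$; $r_3(G)$ denotes the size of the largest subset of $G$ without non-trivial three-term progressions. $\mathcal{H}_2$ is the binary entropy function $\mathcal{H}_2(\theta)=-\theta\log_2\theta-(1-\theta)\log_2(1-\theta)$ for $\theta\in[0,1]$, with the convention $0\log_2 0=0$. The function $\mathcal{H}_4$ is defined by $$2^{\mathcal{H}_4(\rho)}=\inf_{x>0}\, x^{-3\rho}(1+x+x^2+x^3),$$ the infimum being a minimum for $0<\rho<1$. *)

(* Defs.v *)
From mathcomp Require Import all_boot all_order all_algebra all_fingroup.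
From mathcomp Require Import classical_sets boolp reals exp.

Set Implicit Arguments.
Unset Strict Implicit.
Unset Printing Implicit Defensive.

Import Order.TTheory GRing.Theory Num.Theory.

Local Open Scope ring_scope.

Section Progressions.
Variable gT : finGroupType.

Definition nontrivial_3progression (a b c : gT) : bool :=
  [&& a != b, b != c, a != c & (a * c)%g == (b ^+ 2)%g].

Definition progression_free (A : {set gT}) : bool :=
  [forall a in A, forall b in A, forall c in A,
     ~~ nontrivial_3progression a b c].

End Progressions.

Definition r3 (gT : finGroupType) : nat :=
  (\max_(A : {set gT} | progression_free A) #|A|)%N.

(* 'Z_8 as a [finGroupType] is the additive group of the integers modulo 8;
   the dependent finite functions carry the componentwise group law of the
   external direct product of [gproduct]. *)
Definition C8_power (n : nat) : finGroupType := {dffun forall _ : 'I_n, 'Z_8}.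

Section Entropies.
Variable R : realType.
Implicit Types x theta rho : R.

Definition log2 x : R := ln x / ln 2.

(* [ln 0 = 0] in the library, hence the convention 0 log 0 = 0. *)
Definition H2 theta : R :=
  - theta * log2 theta - (1 - theta) * log2 (1 - theta).

(* For 0 <= rho <= 1 the set is bounded below by 1, so that its infimum is
   positive and [2 `^ H4 rho] is equal to it. *)
Definition H4 rho : R :=
  log2 (inf [set x `^ (- (3 * rho)) * (1 + x + x ^+ 2 + x ^+ 3)
            | x in [set x | 0 < x]]%classic).

Definition maximum_point (f : R -> R) (a b x : R) : Prop :=
  a <= x <= b /\ forall y, a <= y <= b -> f y <= f x.

Definition entropy_system (x0 : R) (p : R * R) : Prop :=
  let: (theta1, rho) := p in
  [/\ x0 <= theta1 <= 2^-1,
      4^-1 <= rho <= 2^-1,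
      H4 rho = H2 theta1 + H2 (1 - 2 * theta1) &
      H4 (1 - 2 * rho) = 1 + H2 (1 - 2 * theta1)].

End Entropies.

(* Main.v *)
Require Import Defs.
From mathcomp Require Import all_boot all_order all_algebra all_fingroup.
From mathcomp Require Import classical_sets boolp reals exp.
From mathcomp Require Import sequences.
From mathcomp Require topology normedtype derive.
From mathcomp Require Import zify ring lra.

Import Order.TTheory GRing.Theory Num.Theory.

(** Written additively, a progression is a solution of a + c = b + b in the
    functions from a set of n coordinates to Z/8.  If a and c have the same
    parities, then (a + c)/2 makes sense modulo 4, and it equals a modulo 4
    when a = c.  So A is free of progressions if and only if, for distinct a
    and c of the same parities in A, the element (a + c)/2 of (Z/4)^n is never
    the residue modulo 4 of an element of A.  Call fiber of s the set of the
    elements of A with residue s.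

    The polynomial method is used twice, over F_2.  The indicator of x + y = v
    on (Z/q)^n, for q = 2 or 4, is a sum of products of a monomial in x, one
    in y and one in v, with degrees that add up to n(q - 1) (sum_slices_ffun).
    If a function f on (Z/q)^n is orthogonal to the monomials of small degree,
    then the matrix f(phi a + psi c) is a sum of few matrices of rank one, and
    if it is diagonal, it has few nonzero entries (card_diagonal_le_splits).
    Such an f exists, with support in a given set N, once N has more points
    than there are monomials to be orthogonal to (exists_orthogonal).

    With q = 2, inside one parity class: fewer than about 2^(n H2(1 - 2
    theta)) fibers have more than about 2^(n H2(theta)) elements
    (card_large_fibers).  The sum H2(theta) + H2(1 - 2 theta) decreases on
    [x0, 1/2], so that the fibers above level theta1 contain about 2^(n
    (H2(theta1) + H2(1 - 2 theta1))) elements of each of the 2^n parity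
    classes (card_large_fibers_le).

    With q = 4, once these fibers are removed: a function f on (Z/4)^n that is
    supported on the residues of A can be chosen nonzero on half of A, apart
    from the fibers over an exceptional set of 2^(n H4(1 - 2 rho)) residues,
    and it is nonzero on about 2^(n H4(rho)) elements of each parity class
    (card_small_fibers).  The exceptional fibers are not large, so they
    contain at most about 2^(n (H4(1 - 2 rho) + H2(theta1))) elements.

    The two equations of the system are exactly what makes the three
    contributions equal to (2 2^H4(rho))^n, with a factor linear in n
    (card_midpoint_free_le).  That factor disappears when the bound is applied
    to the powers of A (tensor_power).

    The statements on the system rest on tangents.  The binary entropy lies
    below its tangents by Gibbs' inequality; the infimum that defines H4(rho)
    is attained where the mean degree is 3 rho (critical_min), and this gives
    tangents of H4.  Strict monotonicity follows, hence uniqueness: one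
    equation makes rho decrease with theta, the other makes it increase.
    Existence and location come from the values of both equations at two
    rational points on either side of the solution (system_crossing), where
    the logarithms are enclosed by partial sums of the series of artanh. *)

Set Implicit Arguments.
Unset Strict Implicit.
Unset Printing Implicit Defensive.

Local Open Scope ring_scope.

(** * Matrices that are sums of few rank-one matrices *)

(** A diagonal matrix with nonzero diagonal has full rank, while each summand
    u_j(a) g_j(c) or h_j(a) v_j(c) contributes at most one to the rank. *)
Lemma card_diagonal_le_slices (F : fieldType) (S J : finType) (D : {set S})
    (Q : {set J}) (M : S -> S -> F) (u g h v : J -> S -> F) :
  {in D &, forall a c, M a c =
     \sum_(j in Q) u j a * g j c + \sum_(j in Q) h j a * v j c} ->
  {in D &, forall a c, a != c -> M a c = 0} ->
  {in D, forall a, M a a != 0} -> (#|D| <= 2 * #|Q|)%N.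
Proof.
move=> slices off diag.
pose X := \matrix_(i < #|D|, k < #|D|) M (enum_val i) (enum_val k).
pose left (w : J -> S -> F) :=
  \matrix_(i < #|D|, k < #|Q|) w (enum_val k) (enum_val i).
pose right (w : J -> S -> F) :=
  \matrix_(i < #|Q|, k < #|D|) w (enum_val i) (enum_val k).
have XE : X = left u *m right g + left h *m right v.
  apply/matrixP => i k; rewrite !mxE slices ?enum_valP //.
  by congr (_ + _); rewrite big_enum_val; apply: eq_bigr => j _; rewrite !mxE.
have Xdiag : X = diag_mx (\row_i M (enum_val i) (enum_val i)).
  apply/matrixP => i k; rewrite !mxE; case: eqVneq => [->|ik] //=.
  by rewrite off ?enum_valP // (inj_eq enum_val_inj).
have rkX : \rank X = #|D|.
  apply/mxrank_unit; rewrite unitmxE Xdiag det_diag unitfE.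
  by apply/prodf_neq0=> i _; rewrite mxE diag ?enum_valP.
rewrite -rkX XE mul2n -addnn (leq_trans (mxrank_add _ _)) //.
by apply: leq_add; rewrite (leq_trans (mxrankM_maxr _ _)) // rank_leq_row.
Qed.

(** A homogeneous linear system with more unknowns, the values on N, than
    equations, one for each j in P, has a nonzero solution. *)
Lemma exists_orthogonal (F : fieldType) (V J : finType) (N : {set V})
    (P : {set J}) (E : J -> V -> F) : (#|P| < #|N|)%N ->
  exists f : {ffun V -> F}, [/\ exists v, f v != 0,
    forall v, f v != 0 -> v \in N &
    {in P, forall j, \sum_v f v * E j v = 0}].
Proof.
move=> ltPN.
pose M := \matrix_(i < #|N|, j < #|P|) E (enum_val j) (enum_val i).
have /rowV0Pn[k kM k0] : kermx M != 0.
  rewrite -mxrank_eq0 mxrank_ker -lt0n subn_gt0.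
  by rewrite (leq_ltn_trans (rank_leq_col M)).
have [i ki] : exists i, k 0 i != 0.
  apply/existsP; apply: contraNT k0; rewrite negb_exists => /forallP k0.
  by apply/eqP/rowP => i; rewrite mxE; apply/eqP; move: (k0 i); rewrite negbK.
pose f : {ffun V -> F} := [ffun v => \sum_(i < #|N| | enum_val i == v) k 0 i].
have fE j : f (enum_val j) = k 0 j.
  rewrite ffunE (bigD1 j) //= big1 ?addr0 // => l /andP[/eqP/enum_val_inj ->].
  by rewrite eqxx.
have f0 v : f v != 0 -> v \in N.
  apply: contraNT => vN; rewrite ffunE big_pred0 // => j.
  by apply: contraNF vN => /eqP <-; exact: enum_valP.
exists f; split=> //; first by exists (enum_val i); rewrite fE.
move=> j jP; have /sub_kermxP/rowP/(_ (enum_rank_in jP j)) := kM.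
rewrite !mxE => {2}<-.
rewrite (bigID (mem N)) /= [X in _ + X]big1 ?addr0 => [|v vN]; last first.
  by have -> : f v = 0; [apply: contraNeq vN => /f0 | rewrite mul0r].
rewrite big_enum_val; apply: eq_bigr => l _.
by rewrite fE mxE enum_rankK_in.
Qed.

(** * The addition table of a power of a finite group *)

Section Slices.
Variables (F : fieldType) (C : finZmodType) (q : nat) (e e' : 'I_q -> C -> F).

Definition graded_triple (t : 'I_q * 'I_q * 'I_q) : bool :=
  (t.1.1 + t.1.2 + t.2 == q.-1)%N.

(** For the binomials e_k(x) = C(x, k) modulo 2 this is the Vandermonde
    identity; it says that the addition table of C, seen as a 3-tensor, is a
    sum of products in which the degrees of the three factors are tied
    together. *)
Definition sum_slices : Prop := forall x y v : C, (x + y == v)%:R =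
  \sum_(t | graded_triple t) e t.1.1 x * e t.1.2 y * e' t.2 v.

Variable I : finType.

Definition monomial (c : 'I_q -> C -> F) (m : {ffun I -> 'I_q})
  (x : {ffun I -> C}) : F := \prod_i c (m i) (x i).

Hypothesis eP : sum_slices.

(** The tensor of a power of C is the product of the tensors of the
    coordinates, so that expanding the product gives monomials whose degrees
    are tied together coordinate by coordinate. *)
Lemma sum_slices_ffun (x y v : {ffun I -> C}) : (x + y == v)%:R =
  \sum_(t in ffun_on graded_triple)
    monomial e [ffun i => (t i).1.1] x * monomial e [ffun i => (t i).1.2] y
    * monomial e' [ffun i => (t i).2] v.
Proof.
have -> : (x + y == v)%:R = \prod_i (x i + y i == v i)%:R :> F.
  case: eqP => [/ffunP xyv | xyv].
    by rewrite big1 // => i _; rewrite -xyv ffunE eqxx.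
  have [i xyi] : exists i, x i + y i != v i.
    apply/existsP; apply: contra_notT xyv; rewrite negb_exists => /forallP xyv.
    by apply/ffunP => i; rewrite ffunE; apply/eqP; move: (xyv i); rewrite negbK.
  by rewrite (bigD1 i) //= (negPf xyi) mul0r.
under eq_bigr do rewrite eP.
rewrite bigA_distr_big; apply: eq_bigr => t _.
by rewrite /monomial !big_split /=; congr (_ * _ * _);
   apply: eq_bigr => i _; rewrite ffunE.
Qed.

Implicit Types (P Q : {set {ffun I -> 'I_q}}) (f : {ffun {ffun I -> C} -> F}).

Definition annihilates P f : Prop :=
  {in P, forall m, \sum_v f v * monomial e' m v = 0}.

(** In applications P consists of the monomials of small degree and Q of those
    of degree at most half of what the complement of P leaves. *)
Definition splits P Q : Prop := forall a b c : {ffun I -> 'I_q},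
  (forall i, a i + b i + c i = q.-1)%N -> [\/ c \in P, a \in Q | b \in Q].

(** The Croot-Lev-Pach argument: writing f as the sum of f(v) [x + y = v], only
    the terms whose third monomial lies outside P survive, and each of those
    has its first or its second monomial in Q.  The matrix f(phi a + psi c) is
    thus a sum of 2 |Q| matrices of rank one. *)
Lemma card_diagonal_le_splits (S : finType) (D : {set S}) P Q f
    (phi psi : S -> {ffun I -> C}) :
  splits P Q -> annihilates P f ->
  {in D &, forall a c, a != c -> f (phi a + psi c) = 0} ->
  (#|[set a in D | f (phi a + psi a)%R != 0%R]| <= 2 * #|Q|)%N.
Proof.
move=> splitPQ annihilP off.
pose l (t : {ffun I -> 'I_q * 'I_q * 'I_q}) := [ffun i => (t i).1.1].
pose r (t : {ffun I -> 'I_q * 'I_q * 'I_q}) := [ffun i => (t i).1.2].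
pose co (t : {ffun I -> 'I_q * 'I_q * 'I_q}) :=
  \sum_v f v * monomial e' [ffun i => (t i).2] v.
pose T := ffun_on graded_triple : {pred {ffun I -> 'I_q * 'I_q * 'I_q}}.
pose g m c := \sum_(t in T | (l t \in Q) && (l t == m))
  monomial e (r t) (psi c) * co t.
pose h m a := \sum_(t in T | (l t \notin Q) && (r t == m))
  monomial e (l t) (phi a) * co t.
apply: (@card_diagonal_le_slices _ _ _ _ _ (fun a c => f (phi a + psi c))
  (fun m a => monomial e m (phi a)) g h (fun m c => monomial e m (psi c))).
- move=> a c _ _.
  have -> : f (phi a + psi c) =
      \sum_(t in T) monomial e (l t) (phi a) * monomial e (r t) (psi c) * co t.
    transitivity (\sum_v f v * (phi a + psi c == v)%:R).
      rewrite (bigD1 (phi a + psi c)) //= eqxx mulr1 big1 ?addr0 // => v.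
      by rewrite eq_sym => /negPf ->; rewrite mulr0.
    under eq_bigr do rewrite sum_slices_ffun mulr_sumr.
    rewrite exchange_big; apply: eq_bigr => t _.
    by rewrite mulr_sumr; apply: eq_bigr => v _; rewrite mulrCA.
  (* Terms with left monomial in Q are grouped by it; the others that do not
     vanish are grouped by their right monomial, which must be in Q. *)
  rewrite (bigID (fun t => l t \in Q)) /=; congr (_ + _).
    rewrite (partition_big l (mem Q)) /= => [|t /andP[]//].
    apply: eq_bigr => m mQ; rewrite mulr_sumr.
    apply: eq_big => [t|t /andP[_ /eqP <-]]; first by rewrite andbA.
    by rewrite mulrA.
  rewrite (bigID (fun t => r t \in Q)) /= [X in _ + X]big1 ?addr0; last first.
    move=> t /andP[/andP[tT lQ] rQ]; rewrite /co annihilP ?mulr0 //.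
    have [|//|lQ'|rQ'] := splitPQ (l t) (r t) [ffun i => (t i).2].
    - move=> i; rewrite !ffunE; apply/eqP.
      by move/ffun_onP/(_ i): tT.
    - by rewrite lQ' in lQ.
    - by rewrite rQ' in rQ.
  rewrite (partition_big r (mem Q)) /= => [|t /andP[]//].
  apply: eq_bigr => m mQ; rewrite mulr_suml.
  apply: eq_big => [t|t /andP[_ /eqP <-]].
    case: eqP => [->|]; rewrite ?andbF // ?mQ !andbT //.
  by rewrite mulrAC.
- by move=> a c; rewrite !inE => /andP[aD _] /andP[cD _]; exact: off.
- by move=> a; rewrite inE => /andP[].
Qed.

End Slices.

(** * Binomials modulo 2 on the integers modulo 2 and 4 *)

Lemma Vandermonde3 (m a b c : nat) :
  (\sum_(t : 'I_m.+1 * 'I_m.+1 * 'I_m.+1 | graded_triple t)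
     'C(a, t.1.1) * 'C(b, t.1.2) * 'C(c, t.2) = 'C(a + b + c, m))%N.
Proof.
transitivity (\sum_(i < m.+1) \sum_(j < m.+1)
    \sum_(k < m.+1 | graded_triple (i, j, k)) 'C(a, i) * 'C(b, j) * 'C(c, k))%N.
  by rewrite pair_bigA pair_big_dep; apply: eq_big => [[[i j] k]|[[i j] k] _].
rewrite -addnA -binomial.Vandermonde; apply: eq_bigr => i _.
rewrite -binomial.Vandermonde big_distrr /= (big_ord_widen m.+1 (fun j =>
  'C(a, i) * ('C(b, j) * 'C(c, m - i - j)))%N) ?ltnS ?leq_subr //.
rewrite [RHS]big_mkcond; apply: eq_bigr => j _ /=; case: ltnP => ij.
  have km : (m - i - j < m.+1)%N by lia.
  rewrite (big_pred1 (Ordinal km)) /= ?mulnA // => k.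
  rewrite /graded_triple /= -val_eqE /=.
  by have := ltn_ord i; move: (i : nat) (j : nat) (k : nat) ij => i' j' k'; lia.
rewrite big_pred0 // => k; rewrite /graded_triple /=.
by have := ltn_ord i; move: (i : nat) (j : nat) (k : nat) ij => i' j' k'; lia.
Qed.

Definition binom_mod2 (q : nat) (k : 'I_q) (x : 'Z_q) : 'F_2 := 'C(x, k)%:R.

(** The argument stands for -1 - v, shifted by 2q so as to be a natural number:
    x + y = v in Z/q exactly when x + y + (-1 - v) is -1 modulo q, that is,
    exactly when C(x + y + (-1 - v), q - 1) is odd. *)
Definition binom_mod2_refl (q : nat) (k : 'I_q) (v : 'Z_q) : 'F_2 :=
  'C(q.-1 + (q - v), k)%:R.

Lemma natr_F2 (n : nat) : n%:R = (odd n)%:R :> 'F_2.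
Proof.
have two0 : 2%:R = 0 :> 'F_2 by apply: val_inj.
by rewrite -[n in LHS]odd_double_half natrD -mul2n natrM two0 mul0r addr0.
Qed.

(** The numbers x + y + (2q - 1 - v) stay below 4q, hence the range in which
    the parity of the top binomial has to be known. *)
Lemma sum_slices_bin q : (1 < q)%N ->
  (forall n, n < 4 * q -> odd 'C(n, q.-1) = (n %% q == q.-1))%N ->
  sum_slices (@binom_mod2 q) (@binom_mod2_refl q).
Proof.
case: q => [|[|q]] // _ top x y v; rewrite /binom_mod2 /binom_mod2_refl.
under eq_bigr do rewrite -!natrM.
rewrite -natr_sum Vandermonde3 [RHS]natr_F2 top.
  congr (nat_of_bool _)%:R; rewrite -val_eqE /=.
  have := ltn_ord x; have := ltn_ord y; have := ltn_ord v.
  rewrite /Zp_trunc /=; move: (x : nat) (y : nat) (v : nat) => x' y' v'.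
  rewrite !ltnS => hv hy hx.
  rewrite -[v' in LHS](@modn_small v' q.+2) //.
  rewrite -(eqn_modDr (q.+1 + (q.+2 - v'))).
  have -> : (v' + (q.+1 + (q.+2 - v')) = q.+1 + q.+2)%N by lia.
  by rewrite modnDr [(q.+1 %% _)%N]modn_small.
have := ltn_ord x; have := ltn_ord y; have := ltn_ord v.
by rewrite /Zp_trunc /=; move: (x : nat) (y : nat) (v : nat) => x' y' v'; lia.
Qed.

Lemma sum_slices_Z2 : sum_slices (@binom_mod2 2) (@binom_mod2_refl 2).
Proof.
apply: sum_slices_bin => // n n8.
have /allP : all (fun n => odd 'C(n, 1) == (n %% 2 == 1)%N) (iota 0 8) by [].
by move=> check; apply/eqP/check; rewrite mem_iota.
Qed.

Lemma sum_slices_Z4 : sum_slices (@binom_mod2 4) (@binom_mod2_refl 4).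
Proof.
apply: sum_slices_bin => // n n16.
have /allP : all (fun n => odd 'C(n, 3) == (n %% 4 == 3)%N) (iota 0 16) by [].
by move=> check; apply/eqP/check; rewrite mem_iota.
Qed.

(** * Orthogonal functions over F_2 with heavy support *)

Lemma F2_eq1 (x : 'F_2) : x != 0 -> x = 1.
Proof. by case: x => [[|[|]]] // ? _; apply: val_inj. Qed.

(** The admissible f form a space W over F_2.  The set N of the points of B
    where all of W vanishes is small, since otherwise a nonzero f supported on
    N and orthogonal to P would exist, and would belong to W.  At any other
    point half of W is nonzero, so that an average f captures half of the
    weight outside N. *)
Lemma exists_heavy_orthogonal (V J : finType) (B : {set V}) (P : {set J})
    (E : J -> V -> 'F_2) (w : V -> nat) :
  exists (f : {ffun V -> 'F_2}) (N : {set V}),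
    [/\ forall v, f v != 0 -> v \in B,
        {in P, forall j, \sum_v f v * E j v = 0},
        (#|N| <= #|P|)%N &
        (\sum_(v in B :\: N) w v <= 2 * \sum_(v in B | f v != 0%R) w v)%N].
Proof.
pose W := [set f : {ffun V -> 'F_2} |
  [forall v, (f v != 0) ==> (v \in B)] &&
  [forall j in P, \sum_v f v * E j v == 0]].
have WP (f : {ffun V -> 'F_2}) : reflect ((forall v, f v != 0 -> v \in B) /\
    {in P, forall j, \sum_v f v * E j v = 0}) (f \in W).
  rewrite inE; apply: (iffP andP) => -[fB fP]; split.
  - by move=> v; exact: (implyP (forallP fB v)).
  - by move=> j jP; apply/eqP; exact: (forall_inP fP).
  - by apply/forallP => v; apply/implyP/fB.
  - by apply/forall_inP => j jP; rewrite fP.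
clearbody W.
have WD (f g : {ffun V -> 'F_2}) : f \in W -> g \in W -> f + g \in W.
  move=> /WP[fB fP] /WP[gB gP]; apply/WP; split=> [v|j jP].
    rewrite ffunE; apply: contraNT => vB.
    by rewrite (contraNeq (@fB v) vB) (contraNeq (@gB v) vB) addr0.
  under eq_bigr do rewrite ffunE mulrDl.
  by rewrite big_split /= fP // gP // addr0.
have W0 : 0 \in W.
  apply/WP; split=> [v|j _]; first by rewrite ffunE eqxx.
  by rewrite big1 // => v _; rewrite ffunE mul0r.
pose N := [set v in B | [forall f in W, f v == 0]].
have NP : (#|N| <= #|P|)%N.
  rewrite leqNgt; apply/negP => /(exists_orthogonal E)[f [[v fv] fN fP]].
  have /WP fW : (forall v, f v != 0 -> v \in B) /\
      {in P, forall j, \sum_v f v * E j v = 0}.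
    by split=> // u /fN; rewrite inE => /andP[].
  have := fN v fv; rewrite inE => /andP[_ /forall_inP/(_ f fW)].
  by rewrite (negPf fv).
pose nz v := [set f : {ffun V -> 'F_2} | f v != 0].
(* Adding a g in W with g(v) nonzero exchanges the f with f(v) zero and those
   with f(v) nonzero. *)
have half v : v \in B :\: N -> (2 * #|W :&: nz v| = #|W|)%N.
  rewrite !inE negb_and => /andP[/orP[/negP//|] Nv vB].
  have [g gW gv] : exists2 g, g \in W & g v != 0.
    by move: Nv; rewrite negb_forall_in => /exists_inP[g gW gv]; exists g.
  rewrite -(cardsID (nz v) W) mul2n -addnn; congr (_ + _)%N.
  have gK : involutive (fun f : {ffun V -> 'F_2} => f + g).
    move=> f; apply/ffunP => u; rewrite !ffunE -addrA.
    have [->|/F2_eq1->] := eqVneq (g u) 0; first by rewrite !addr0.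
    by rewrite (_ : 1 + 1 = 0) ?addr0 //; apply: val_inj.
  rewrite -(card_imset _ (inv_inj gK)); apply: eq_card => f.
  apply/imsetP/idP => [[h]|]; rewrite !inE.
    move=> /andP[hW /F2_eq1 hv] ->; rewrite WD // ffunE hv (F2_eq1 gv) andbT.
    by rewrite negbK; apply/eqP/val_inj.
  rewrite negbK => /andP[/eqP fv fW]; exists (f + g); last by rewrite gK.
  by rewrite !inE WD // ffunE fv add0r.
pose S := (\sum_(v in B :\: N) w v)%N.
have [f fW fS] : exists2 f, f \in W &
    (S <= 2 * \sum_(v in B | f v != 0%R) w v)%N.
  apply/exists_inP; apply: contraT.
  rewrite negb_exists_in => /forall_inP small.
  have : (\sum_(f in W) (2 * \sum_(v in B | f v != 0%R) w v).+1 <= #|W| * S)%N.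
    by rewrite -sum_nat_const; apply: leq_sum => f fW; rewrite ltnNge small.
  under eq_bigr do rewrite -addn1.
  rewrite big_split /= sum1_card -big_distrr /=.
  suff : (#|W| * S <= 2 * \sum_(f in W) \sum_(v in B | f v != 0%R) w v)%N.
    have : (0 < #|W|)%N by apply/card_gt0P; exists 0.
    move=> W1 le1 /leq_trans/(_ le1); apply: contraLR => _.
    by rewrite -ltnNge -addn1; apply: leq_add.
  rewrite (exchange_big_dep (mem B)) /= => [|? ? _ /andP[]//].
  apply: (@leq_trans (2 * \sum_(v in B :\: N) #|W :&: nz v| * w v)).
    rewrite !big_distrr /=; apply: leq_sum => v vBN.
    by rewrite mulnA half.
  rewrite leq_mul2l /=.
  rewrite [leqRHS](big_setID N) /= addnC.
  rewrite (leq_trans _ (leq_addr _ _)) //.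
  apply: leq_sum => v; rewrite inE => /andP[_ vB].
  rewrite -sum_nat_const.
  apply: eq_leq; apply: eq_bigl => f.
  by rewrite !inE vB.
by exists f, N; move/WP: fW => [fB fP]; split.
Qed.

(** * Midpoints in the integers modulo 8 *)

Definition floor_half (a : 'Z_8) : 'Z_4 := inZp a./2.
Definition ceil_half (a : 'Z_8) : 'Z_4 := inZp (uphalf a).
Definition reduce4 (a : 'Z_8) : 'Z_4 := inZp a.
Definition parity (s : 'Z_4) : 'Z_2 := inZp s.
Definition top_bit (s : 'Z_4) : 'Z_2 := inZp s./2.
Definition quarter (a : 'Z_8) : 'Z_2 := inZp (a %/ 4).

(** For a and c of the same parity, floor(a/2) + ceil(c/2) is (a + c)/2, which
    is well defined modulo 4; and 2b determines b modulo 4. *)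
Lemma halves_sum (a b c : 'Z_8) : parity (reduce4 a) = parity (reduce4 c) ->
  floor_half a + ceil_half c = reduce4 b -> a + c = b + b.
Proof.
move=> /(congr1 val) /= h1 /(congr1 val) /= h2; apply: val_inj => /=.
have := ltn_ord a; have := ltn_ord b; have := ltn_ord c.
rewrite /Zp_trunc /= in h1 h2 *; lia.
Qed.

Lemma halves_diag (a : 'Z_8) : floor_half a + ceil_half a = reduce4 a.
Proof.
apply: val_inj => /=; have := ltn_ord a; rewrite /Zp_trunc /=; lia.
Qed.

(** For a = s + 4t and c = s + 4t' the sum below is the top bit of (a + c)/2
    modulo 4, whose bottom bit is that of s. *)
Lemma quarters_sum (a b c : 'Z_8) : reduce4 a = reduce4 c ->
  parity (reduce4 a) = parity (reduce4 b) ->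
  quarter a + (top_bit (reduce4 c) + quarter c) = top_bit (reduce4 b) ->
  a + c = b + b.
Proof.
move=> /(congr1 val) /= h1 /(congr1 val) /= h2 /(congr1 val) /= h3.
apply: val_inj => /=.
have := ltn_ord a; have := ltn_ord b; have := ltn_ord c.
rewrite /Zp_trunc /= in h1 h2 h3 *; lia.
Qed.

Lemma quarters_diag (a : 'Z_8) :
  quarter a + (top_bit (reduce4 a) + quarter a) = top_bit (reduce4 a).
Proof.
apply: val_inj => /=; have := ltn_ord a; rewrite /Zp_trunc /=; lia.
Qed.

Lemma bits_inj (s s' : 'Z_4) :
  parity s = parity s' -> top_bit s = top_bit s' -> s = s'.
Proof.
move=> /(congr1 val) /= h1 /(congr1 val) /= h2; apply: val_inj => /=.
have := ltn_ord s; have := ltn_ord s'; rewrite /Zp_trunc /= in h1 h2 *; lia.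
Qed.

(** * Fibers of a midpoint-free set *)

Section ProgressionFree.
Variable I : finType.

Definition pointwise (C D : Type) (f : C -> D) (x : {ffun I -> C}) :
  {ffun I -> D} := [ffun i => f (x i)].

(** In additive notation a triple is degenerate as soon as a = c: if a = b, or
    b = c, then a + c = b + b forces a = c. *)
Definition midpoint_free (A : {set {ffun I -> 'Z_8}}) : Prop :=
  {in A & &, forall a b c, a + c = b + b -> a = c}.

Definition fiber (A : {set {ffun I -> 'Z_8}}) (s : {ffun I -> 'Z_4}) :=
  [set a in A | pointwise reduce4 a == s].

(** If there were more such residues s than conditions, some nonzero f on
    (Z/2)^I, supported on their top bits, would be orthogonal to P.  Choose s
    with f nonzero at its top bits; then, on the fiber of s, the matrix
    f(quarter a + psi c) is a nonzero multiple of the identity, because (a +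
    c)/2 is the residue of an element of A only for a = c.  Hence that fiber
    has at most 2 |Q| elements. *)
Lemma card_large_fibers (A : {set {ffun I -> 'Z_8}})
    (P Q : {set {ffun I -> 'I_2}}) (r : {ffun I -> 'Z_2}) :
  midpoint_free A -> splits P Q ->
  (#|[set s | (pointwise parity s == r) && (2 * #|Q| < #|fiber A s|)]|
    <= #|P|)%N.
Proof.
move=> freeA splitPQ; set L := [set s | _]; rewrite leqNgt; apply/negP => ltPL.
have top_inj : {in L &, injective (pointwise top_bit)}.
  move=> s s'; rewrite !inE => /andP[/eqP/ffunP rs _] /andP[/eqP/ffunP rs' _].
  move=> /ffunP tss'; apply/ffunP => i; apply: bits_inj.
    by move: (rs i) (rs' i); rewrite !ffunE => -> ->.
  by move: (tss' i); rewrite !ffunE.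
rewrite -(card_in_imset top_inj) in ltPL.
have [f [[v fv] fL fP]] :=
  exists_orthogonal (monomial (@binom_mod2_refl 2) (I := I)) ltPL.
have /imsetP[s sL sv] := fL v fv.
pose psi a := pointwise (fun c => top_bit (reduce4 c) + quarter c) a.
have diag a : a \in fiber A s -> pointwise quarter a + psi a = v.
  rewrite inE => /andP[_ /eqP/ffunP as_]; rewrite sv; apply/ffunP => i.
  by rewrite !ffunE quarters_diag -as_ ffunE.
have off : {in fiber A s &, forall a c, a != c ->
    f (pointwise quarter a + psi c) = 0}.
  move=> a c.
  rewrite !inE => /andP[aA /eqP/ffunP as_] /andP[cA /eqP/ffunP cs].
  apply: contraNeq => /fL/imsetP[s' s'L /ffunP ss'].
  have : (0 < #|fiber A s'|)%N.
    by move: s'L; rewrite inE => /andP[_]; apply: leq_trans.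
  case/card_gt0P => b; rewrite inE => /andP[bA /eqP/ffunP bs'].
  apply/eqP/(freeA a b c) => //; apply/ffunP => i; rewrite !ffunE.
  move: sL s'L; rewrite !inE => /andP[/eqP/ffunP rs _] /andP[/eqP/ffunP rs' _].
  move: (as_ i) (cs i) (bs' i) (rs i) (rs' i) (ss' i); rewrite !ffunE.
  move=> as_i csi bsi rsi rsi' ssi; apply: quarters_sum.
  - by rewrite as_i.
  - by rewrite as_i bsi rsi.
  - by rewrite bsi.
have := card_diagonal_le_splits sum_slices_Z2 splitPQ fP off.
apply/negP; rewrite -ltnNge.
move: sL; rewrite inE => /andP[_] /leq_trans; apply.
apply: subset_leq_card; apply/fintype.subsetP => a aF.
by rewrite inE aF /= diag.
Qed.

(** Take f on (Z/4)^I supported on the residues of A, orthogonal to P and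
    nonzero on at least half of A, weighted by fibers, outside the fibers over
    a small set N.  In each of the 2^n parity classes the matrix f((a + c)/2)
    is diagonal, so that f is nonzero at no more than 2 |Q| of the elements of
    the class. *)
Lemma card_small_fibers (A : {set {ffun I -> 'Z_8}})
    (P Q : {set {ffun I -> 'I_4}}) :
  midpoint_free A -> splits P Q ->
  exists2 N : {set {ffun I -> 'Z_4}}, (#|N| <= #|P|)%N &
    (#|A| <= \sum_(s in N) #|fiber A s| + 4 * 2 ^ #|I| * #|Q|)%N.
Proof.
move=> freeA splitPQ.
pose B := [set pointwise reduce4 a | a in A].
have [f [N [fB fP NP wN]]] := exists_heavy_orthogonal B P
  (monomial (@binom_mod2_refl 4) (I := I)) (fun s => #|fiber A s|).
exists N => //.
have cardA (D : {set {ffun I -> 'Z_8}}) (K : finType) (k : _ -> K)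
    (E : {set K}) : {in D, forall a, k a \in E} ->
    #|D| = (\sum_(s in E) #|[set a in D | k a == s]|)%N.
  move=> DE; rewrite -sum1_card (partition_big k (mem E)) //=.
  apply: eq_bigr => s _; rewrite -sum1_card.
  by apply: eq_bigl => a; rewrite inE.
rewrite (cardA A _ (pointwise reduce4) B) => [|a aA]; last exact: imset_f.
rewrite (big_setID N) /=; apply: leq_add.
  rewrite [leqRHS](big_setID B) /= finset.setIC leq_addr //.
apply: leq_trans wN _; rewrite -mulnA -[4%N]/(2 * 2)%N -mulnA leq_mul2l /=.
pose A1 := [set a in A | f (pointwise reduce4 a) != 0].
have -> : (\sum_(s in B | f s != 0%R) #|fiber A s| = #|A1|)%N.
  rewrite (cardA A1 _ (pointwise reduce4) [set s in B | f s != 0]) => [|a].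
    rewrite (eq_bigl (fun s => s \in [set s in B | f s != 0])) => [|s];
      last by rewrite inE.
    apply: eq_bigr => s; rewrite inE => /andP[_ fs].
    apply: eq_card => a; rewrite !inE.
    by case: eqP => [->|]; rewrite ?fs ?andbT ?andbF.
  by rewrite !inE => /andP[aA ->]; rewrite imset_f.
rewrite (cardA A1 _ (pointwise (parity \o reduce4)) [set: _]) //.
have -> : (2 * (2 ^ #|I| * #|Q|)
    = \sum_(r in [set: {ffun I -> 'Z_2}]) 2 * #|Q|)%N.
  by rewrite sum_nat_const cardsT card_ffun card_ord mulnCA.
apply: leq_sum => r _.
pose D := [set a in A | pointwise (parity \o reduce4) a == r].
have off : {in D &, forall a c, a != c ->
    f (pointwise floor_half a + pointwise ceil_half c) = 0}.
  move=> a c.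
  rewrite !inE => /andP[aA /eqP/ffunP ar] /andP[cA /eqP/ffunP cr].
  apply: contraNeq => /fB/imsetP[b bA /ffunP sb].
  apply/eqP/(freeA a b c) => //; apply/ffunP => i; rewrite !ffunE.
  move: (ar i) (cr i) (sb i); rewrite !ffunE => ari cri sbi.
  by apply: halves_sum => //; rewrite [LHS]ari [RHS]cri.
apply: leq_trans (card_diagonal_le_splits sum_slices_Z4 splitPQ fP off).
apply: subset_leq_card; apply/fintype.subsetP => a.
rewrite !inE => /andP[/andP[-> fa] ->] /=.
rewrite (_ : _ + _ = pointwise reduce4 a) //.
by apply/ffunP => i; rewrite !ffunE halves_diag.
Qed.

End ProgressionFree.

(** * Counting monomials of small degree *)

Section Degrees.
Variables (R : realType) (I : finType).

Definition degree (q : nat) (m : {ffun I -> 'I_q}) : nat := \sum_i m i.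

Definition low_degree (q : nat) (t : R) : {set {ffun I -> 'I_q}} :=
  [set m | (degree m)%:R <= t].

(** Markov's inequality for the generating function: a monomial of degree at
    most t has x^degree >= x^t, as x <= 1. *)
Lemma card_low_degree (q : nat) (t x : R) : 0 < x <= 1 ->
  #|low_degree q t|%:R <= x `^ (- t) * (\sum_(i < q) x ^+ i) ^+ #|I|.
Proof.
move=> /andP[x0 x1]; rewrite mulrC powRN ler_pdivlMr ?powR_gt0 //.
have -> : (\sum_(i < q) x ^+ i) ^+ #|I|
    = \sum_(m : {ffun I -> 'I_q}) x ^+ degree m.
  rewrite -prodr_const (bigA_distr_bigA (fun _ j => x ^+ (j : 'I_q))) /=.
  by apply: eq_bigr => m _; rewrite prodrXr.
rewrite -sum1_card natr_sum mulr_suml [leRHS](bigID (mem (low_degree q t))) /=.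
rewrite ler_wpDr ?sumr_ge0 // => [m _|]; first exact/exprn_ge0/ltW.
apply: ler_sum => m; rewrite inE mul1r => mt.
by rewrite -powR_mulrn ?(ltW x0) //; apply: ger_powR; rewrite ?x0 ?x1.
Qed.

Lemma degree_sum (q k : nat) (a b c : {ffun I -> 'I_q}) :
  (forall i, a i + b i + c i = k)%N ->
  (degree a + degree b + degree c = #|I| * k)%N.
Proof.
move=> abc; rewrite /degree -!big_split /= (eq_bigr (fun=> k)) //.
by rewrite sum_nat_const.
Qed.

(** The three degrees add up to n(q - 1); if the third exceeds n(q - 1) - 2t,
    then one of the first two is below t. *)
Lemma splits_low_degree (q : nat) (t : R) :
  splits (low_degree q ((#|I| * q.-1)%:R - 2 * t)) (low_degree q t).
Proof.
move=> a b c abc; have := degree_sum abc.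
move=> /(congr1 (fun n => n%:R : R)); rewrite !natrD => <-; rewrite !inE.
have [ct|ct] := leP (degree c)%:R; first by constructor 1.
have [at_|at_] := leP (degree a)%:R; first by constructor 2.
have [bt|bt] := leP (degree b)%:R; first by constructor 3.
by lra.
Qed.

(** For q = 2 and an integer bound k one gains a unit by integrality, which
    makes the fiber sizes between consecutive levels k and k + 1 match the
    monomials of degree at most n - 2(k + 1). *)
Lemma splits_low_degree2 (k : nat) :
  splits (low_degree 2 (#|I|%:R - 2 * k.+1%:R)) (low_degree 2 k%:R).
Proof.
move=> a b c abc; have := degree_sum abc; rewrite muln1 !inE => <-.
have -> : ((degree c)%:R
      <= (degree a + degree b + degree c)%:R - 2 * k.+1%:R :> R)
    = (degree c + 2 * k.+1 <= degree a + degree b + degree c)%N :> bool.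
  by rewrite lerBrDr -(ler_nat R) !natrD natrM.
rewrite !ler_nat.
case: (leqP (degree a) k) => ak; first by constructor 2.
case: (leqP (degree b) k) => bk; first by constructor 3.
by constructor 1; lia.
Qed.

End Degrees.

(** * Large fibers *)

Section Bound.
Variables (R : realType) (I : finType).

Lemma midpoint_free_sub (A B : {set {ffun I -> 'Z_8}}) :
  B \subset A -> midpoint_free A -> midpoint_free B.
Proof.
move=> /fintype.subsetP BA freeA a b c aB bB cB.
exact: (freeA a b c (BA _ aB) (BA _ bB) (BA _ cB)).
Qed.

Local Notation n := #|I|.

Lemma powR_expn_mul (x t u : R) : 0 <= u ->
  (x `^ t * u) ^+ n = x `^ (t * n%:R) * u ^+ n.
Proof. by move=> u0; rewrite exprMn -(powR_mulrn _ (powR_ge0 x t)) -powRrM. Qed.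

(** The left side is exponential in k with ratio y^2/x <= 1.  For x and y
    chosen optimally for theta this ratio condition says that theta is past
    the maximum of H2(theta) + H2(1 - 2 theta). *)
Lemma tradeoff_mono (x y theta k : R) : 0 < x -> 0 < y -> y ^+ 2 <= x ->
  theta * n%:R <= k ->
  x `^ (- k) * y `^ (- (n%:R - 2 * k))
    <= x `^ (- theta * n%:R) * y `^ (- (1 - 2 * theta) * n%:R).
Proof.
move=> x0 y0 yx tk; rewrite /powR !gt_eqF // -!expRD ler_expR.
have : ln (y ^+ 2) <= ln x by rewrite ler_ln // posrE // exprn_gt0.
rewrite lnXn // => yx'.
have : 0 <= (k - theta * n%:R) * (ln x - ln y *+ 2).
  by apply: mulr_ge0; rewrite subr_ge0.
by lra.
Qed.

Section Large.
Variables (A : {set {ffun I -> 'Z_8}}) (theta x y : R).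
Hypotheses (freeA : midpoint_free A) (theta0 : 0 <= theta).
Hypotheses (x01 : 0 < x <= 1) (y01 : 0 < y <= 1) (yx : y ^+ 2 <= x).

(* For x = theta/(1 - theta) and y = (1 - 2 theta)/(2 theta) these are
   2^H2(theta) and 2^H2(1 - 2 theta). *)
Let c1 := x `^ (- theta) * (1 + x).
Let c2 := y `^ (- (1 - 2 * theta)) * (1 + y).

Definition large_fiber s := 2 * c1 ^+ n < #|fiber A s|%:R.

Local Notation low k := (low_degree I 2 (k%:R : R)).

(** A large fiber sits between two consecutive values of 2 |low k|, and its
    size forces the upper level above theta n. *)
Lemma large_fiber_level s : large_fiber s ->
  exists2 k : 'I_n, theta * n%:R <= k.+1%:R &
    (2 * #|low k| < #|fiber A s| <= 2 * #|low k.+1|)%N.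
Proof.
move=> sL.
have [x0 x1] := andP x01.
have lown : (#|fiber A s| <= 2 * #|low n|)%N.
  have := card_large_fibers (pointwise parity s) freeA
    (@splits_low_degree2 R I n).
  (* At k = n no monomial meets the degree condition of card_large_fibers, so
     that no fiber exceeds 2 |low n|. *)
  rewrite [X in (_ <= X)%N -> _](_ : _ = 0)%N; last first.
    apply/eqP; rewrite cards_eq0; apply/eqP/setP => m; rewrite !inE.
    apply/negbTE; rewrite -ltNge (lt_le_trans _ (ler0n _ _)) //.
    by rewrite -natr1 subr_lt0; have := ler0n R n; lra.
  rewrite leqn0 cards_eq0 => /eqP/setP/(_ s); rewrite !inE eqxx /=.
  by move=> /negbT; rewrite -leqNgt.
have ex : exists k, (#|fiber A s| <= 2 * #|low k|)%N by exists n.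
case: (ex_minnP ex) => k fk kmin.
have kt : theta * n%:R < k%:R.
  rewrite ltNge; apply/negP => kt; move: sL.
  rewrite /large_fiber ltNge => /negP; apply.
  rewrite (le_trans (_ : _ <= (2 * #|low k|)%:R)) ?ler_nat // natrM.
  rewrite ler_pM2l // (le_trans (card_low_degree _ _ _ x01)) //.
  rewrite !big_ord_recl big_ord0 /= addr0 /c1 powR_expn_mul; last by lra.
  rewrite ler_wpM2r ?exprn_ge0 //; first by lra.
  by apply: ger_powR; rewrite ?x01 // mulNr lerN2.
case: k => [|k] in fk kmin kt *.
  by move: kt; rewrite ltNge mulr_ge0.
have kn : (k < n)%N by apply: kmin.
exists (Ordinal kn); first exact: ltW.
by rewrite fk andbT ltnNge; apply/negP => /kmin; rewrite ltnn.
Qed.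

(** At level k there are at most |low (n - 2(k+1))| fibers, of at most 2 |low
    (k+1)| elements each; the product is largest at the lowest admissible
    level, k + 1 = theta n, and there are n levels. *)
Lemma card_large_fibers_le (r : {ffun I -> 'Z_2}) :
  \sum_(s | (pointwise parity s == r) && large_fiber s) #|fiber A s|%:R
    <= n%:R * 2 * (c1 * c2) ^+ n.
Proof.
pose lev k s := (2 * #|low k| < #|fiber A s|)%N.
have [x0 x1] := andP x01; have [y0 y1] := andP y01.
apply: (@le_trans _ _ (\sum_(s | pointwise parity s == r)
   \sum_(k < n | (theta * n%:R <= k.+1%:R) && lev k s) (2 * #|low k.+1|)%:R)).
  rewrite big_mkcondr; apply: ler_sum => s _.
  case: ifP => [sL|_]; last by rewrite sumr_ge0.
  have [k tk /andP[levk fk]] := large_fiber_level sL.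
  rewrite (bigD1 k) /=; last by rewrite tk.
  by rewrite ler_wpDr ?sumr_ge0 ?ler_nat.
rewrite (exchange_big_dep (fun k : 'I_n => theta * n%:R <= k.+1%:R)) /=;
  last by move=> s k _ /andP[].
rewrite [X in _ <= X * _ * _](_ : _ = \sum_(k < n) (1 : R)); last first.
  by rewrite sumr_const card_ord.
rewrite -mulrA mulr_suml.
rewrite [leRHS](bigID (fun k : 'I_n => theta * n%:R <= k.+1%:R)) /= ler_wpDr //.
  apply: sumr_ge0 => k _; rewrite mul1r mulr_ge0 // exprn_ge0 //.
  by rewrite /c1 /c2 !mulr_ge0 ?powR_ge0 //; lra.
apply: ler_sum => k tk; rewrite mul1r.
rewrite (eq_bigl (fun s => s \in
    [set s | (pointwise parity s == r) && lev k s]));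
  last by move=> s; rewrite inE tk.
rewrite sumr_const -[X in X <= _]mulr_natr natrM -mulrA.
rewrite ler_pM2l //.
have lk := card_low_degree I 2 (k.+1%:R) x01.
have hk : #|[set s | (pointwise parity s == r) && lev k s]|%:R
    <= y `^ (- (n%:R - 2 * k.+1%:R)) * (1 + y) ^+ n.
  apply: le_trans (_ : #|low_degree I 2 (n%:R - 2 * k.+1%:R : R)|%:R <= _).
    rewrite ler_nat.
    exact: card_large_fibers freeA (@splits_low_degree2 R I k).
  apply: le_trans (card_low_degree _ _ _ y01) _.
  by rewrite !big_ord_recl big_ord0 /= addr0.
move: lk; rewrite !big_ord_recl big_ord0 /= addr0 => lk.
apply: le_trans (ler_pM _ _ lk hk) _ => //.
rewrite [leRHS]exprMn /c1 /c2 !powR_expn_mul; try lra.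
rewrite mulrACA [leRHS]mulrACA ler_wpM2r ?tradeoff_mono //.
by rewrite mulr_ge0 // exprn_ge0 //; lra.
Qed.

End Large.
End Bound.

(** * The bound up to a linear factor *)

(** The large fibers contribute at most 2n L^n to each of the 2^n parity
    classes.  Once they are removed, card_small_fibers leaves (2 c2)^n
    exceptional fibers of at most 2 c1^n elements, and 4 (2 L)^n further
    elements. *)
Lemma card_midpoint_free_le (R : realType) (I : finType)
    (A : {set {ffun I -> 'Z_8}}) (theta rho x y z w L : R) :
  midpoint_free A -> 0 <= theta ->
  0 < x <= 1 -> 0 < y <= 1 -> 0 < z <= 1 -> 0 < w <= 1 -> y ^+ 2 <= x ->
  let c1 := x `^ (- theta) * (1 + x) in
  let c2 := y `^ (- (1 - 2 * theta)) * (1 + y) in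
  c1 * c2 <= L ->
  z `^ (- (3 * rho)) * (1 + z + z ^+ 2 + z ^+ 3) <= L ->
  w `^ (- (3 * (1 - 2 * rho))) * (1 + w + w ^+ 2 + w ^+ 3) <= 2 * c2 ->
  #|A|%:R <= (6 + 2 * #|I|%:R) * (2 * L) ^+ #|I|.
Proof.
move=> freeA theta0 x01 y01 z01 w01 yx c1 c2 c12L zL w2.
have [x0 x1] := andP x01; have [y0 y1] := andP y01.
have [z0 z1] := andP z01; have [w0 w1] := andP w01.
have c1_ge0 : 0 <= c1 by rewrite mulr_ge0 ?powR_ge0 //; lra.
have c2_ge0 : 0 <= c2 by rewrite mulr_ge0 ?powR_ge0 //; lra.
have L0 : 0 <= L by apply: le_trans c12L; rewrite mulr_ge0.
have poly4 (v : R) : \sum_(i < 4) v ^+ i = 1 + v + v ^+ 2 + v ^+ 3.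
  by rewrite !big_ord_recl big_ord0 /= addr0 !addrA.
have low4 (v t b : R) : 0 < v <= 1 ->
    v `^ (- t) * (1 + v + v ^+ 2 + v ^+ 3) <= b ->
    #|low_degree I 4 (t * #|I|%:R)|%:R <= b ^+ #|I|.
  move=> v01 vb; have [v0 v1] := andP v01.
  have p0 : 0 <= 1 + v + v ^+ 2 + v ^+ 3.
    by rewrite !addr_ge0 ?exprn_ge0 // ltW.
  apply: le_trans (card_low_degree _ _ _ v01) _.
  rewrite poly4 -mulNr -powR_expn_mul //.
  apply: lerXn2r => //; rewrite nnegrE ?mulr_ge0 ?powR_ge0 //.
  by rewrite (le_trans _ vb) ?mulr_ge0 ?powR_ge0.
pose T := 2 * c1 ^+ #|I|.
pose small := [set a in A | #|fiber A (pointwise reduce4 a)|%:R <= T].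
have freeS : midpoint_free small.
  apply: midpoint_free_sub freeA; apply/fintype.subsetP => a.
  by rewrite inE => /andP[].
have T0 : 0 <= T by rewrite mulr_ge0 ?exprn_ge0.
have fibS s : #|fiber small s|%:R <= T.
  have [->|[a]] := set_0Vmem (fiber small s); first by rewrite cards0.
  rewrite !inE => /andP[/andP[_ aT] /eqP <-]; apply: le_trans aT.
  rewrite ler_nat subset_leq_card //; apply/fintype.subsetP => b.
  by rewrite !inE => /andP[/andP[-> _] ->].
have split4 : splits (low_degree I 4 ((3 * (1 - 2 * rho)) * #|I|%:R))
    (low_degree I 4 (3 * rho * #|I|%:R)).
  have -> : 3 * (1 - 2 * rho) * #|I|%:R
      = (#|I| * 4.-1)%:R - 2 * (3 * rho * #|I|%:R) by rewrite natrM /=; ring.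
  exact: splits_low_degree.
have [N NP smallN] := card_small_fibers freeS split4.
have smallb : #|small|%:R <= 6 * (2 * L) ^+ #|I|.
  have NP' := le_trans (_ : #|N|%:R <= _) (low4 _ _ _ w01 w2).
  apply: (@le_trans _ _ ((2 * c2) ^+ #|I| * T + 4 * 2 ^+ #|I| * L ^+ #|I|)).
    apply: le_trans (_ : (\sum_(s in N) #|fiber small s|
      + 4 * 2 ^ #|I| * #|low_degree I 4 (3 * rho * #|I|%:R)|)%:R <= _).
      by rewrite ler_nat.
    rewrite natrD natr_sum !natrM natrX; apply: lerD.
      apply: le_trans (_ : \sum_(s in N) T <= _); first exact: ler_sum.
      rewrite sumr_const -[leLHS]mulr_natl ler_wpM2r //; apply: NP'.
      by rewrite ler_nat.
    rewrite ler_wpM2l ?mulr_ge0 ?exprn_ge0 //; exact: low4 z01 zL.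
  have : (2 * (c1 * c2)) ^+ #|I| <= (2 * L) ^+ #|I|.
    apply: lerXn2r; rewrite ?nnegrE; last by rewrite ler_wpM2l.
      by rewrite mulr_ge0 // mulr_ge0.
    by rewrite mulr_ge0.
  rewrite /T !exprMn; lra.
have -> : #|A| = (#|small| + #|A :\: small|)%N.
  rewrite -(cardsID small A); congr (_ + _)%N; apply: eq_card => a.
  by rewrite !inE; case: (a \in A).
rewrite natrD mulrDl lerD //.
have -> : #|A :\: small|%:R = \sum_(r : {ffun I -> 'Z_2})
   \sum_(s | (pointwise parity s == r) && large_fiber A theta x s)
     #|fiber A s|%:R :> R.
  transitivity (\sum_(s | large_fiber A theta x s) #|fiber A s|%:R : R).
    rewrite -sum1_card (partition_big (pointwise reduce4)
      (large_fiber A theta x)) => [|a]; last first.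
      rewrite !inE => /andP[aS aA].
      by rewrite /large_fiber ltNge; move: aS; rewrite aA.
    rewrite natr_sum; apply: eq_bigr => s sL.
    congr _%:R; rewrite sum1_card; apply: eq_card => a.
    rewrite -topredE /= !inE; case: eqP => [as_|]; rewrite ?andbF // !andbT.
    by rewrite as_ (lt_geF sL) andbF.
  rewrite (partition_big (pointwise parity) xpredT) //=.
  by apply: eq_bigr => r _; apply: eq_bigl => s; rewrite andbC.
apply: (@le_trans _ _ (\sum_(r : {ffun I -> 'Z_2}) #|I|%:R * 2 * L ^+ #|I|)).
  apply: ler_sum => r _.
  apply: le_trans (card_large_fibers_le freeA theta0 x01 y01 yx r) _.
  rewrite ler_wpM2l ?mulr_ge0 //.
  by apply: lerXn2r => //; rewrite nnegrE; apply: mulr_ge0.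
rewrite sumr_const card_ffun card_ord -[leLHS]mulr_natl natrX exprMn.
by rewrite le_eqVlt; apply/orP; left; apply/eqP; ring.
Qed.

(** * Removing the linear factor *)

(** Bernoulli's inequality for t^m, squared, gives quadratic growth if t > 1. *)
Lemma le1_of_exp_linear (R : realType) (t a b : R) : 0 <= t ->
  (forall k : nat, t ^+ k <= a + b * k%:R) -> t <= 1.
Proof.
move=> t0 tk; rewrite leNgt; apply/negP => t1.
pose e := t - 1; have e0 : 0 < e by rewrite subr_gt0.
have bern k : 1 + k%:R * e <= t ^+ k.
  elim: k => [|k IH]; first by rewrite expr0 mul0r addr0.
  have k0 : 0 <= k%:R :> R by rewrite ler0n.
  rewrite exprS -natr1; apply: (@le_trans _ _ (t * (1 + k%:R * e))).
    have -> : t = 1 + e by rewrite /e; ring.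
    have : 0 <= k%:R * e * e by rewrite !mulr_ge0 // ltW.
    by lra.
  by rewrite ler_wpM2l.
pose m := Num.bound ((`|a| + 2 * `|b| + 1) / e ^+ 2).
have mE : `|a| + 2 * `|b| + 1 < m%:R * e ^+ 2.
  rewrite -ltr_pdivrMr ?exprn_gt0 //; apply: archi_boundP.
  by rewrite divr_ge0 ?exprn_ge0 ?(ltW e0) // !addr_ge0 // mulr_ge0.
have := tk (m * 2)%N; rewrite exprM natrM.
have m1 : 1 <= m%:R :> R.
  rewrite (ler_nat _ 1) lt0n; apply/negP => /eqP m0.
  by move: mE; rewrite m0 mul0r; have := normr_ge0 a; have := normr_ge0 b; lra.
have tm : m%:R * e <= t ^+ m by apply: le_trans (bern m); lra.
have : (m%:R * e) ^+ 2 <= (t ^+ m) ^+ 2.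
  by apply: lerXn2r; rewrite ?nnegrE ?exprn_ge0 // mulr_ge0 // ltW.
have : m%:R * (`|a| + 2 * `|b| + 1) < (m%:R * e) ^+ 2.
  rewrite exprMn expr2 -mulrA ltr_pM2l //; lra.
have ha := ler_norm a; have hb := ler_norm b.
have : 0 <= m%:R * (`|b| - b) by rewrite mulr_ge0 // subr_ge0.
have : 0 <= (m%:R - 1) * `|a| by rewrite mulr_ge0 // subr_ge0.
by lra.
Qed.

(** The k-th cartesian power of A, a set of functions on 'I_k * I, is again
    free of midpoints: an a + c = b + b in it gives a = c in every block.  Its
    cardinality is that of A to the power k, which a linear factor cannot
    follow. *)
Lemma tensor_power (R : realType) (M a b : R) (I : finType)
    (A : {set {ffun I -> 'Z_8}}) : 0 < M -> midpoint_free A ->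
  (forall (J : finType) (B : {set {ffun J -> 'Z_8}}), midpoint_free B ->
    #|B|%:R <= (a + b * #|J|%:R) * M ^+ #|J|) ->
  #|A|%:R <= M ^+ #|I|.
Proof.
move=> M0 freeA bound; have MI : 0 < M ^+ #|I| by rewrite exprn_gt0.
rewrite -[leRHS]mul1r -ler_pdivrMr //.
apply: (@le1_of_exp_linear _ _ a (b * #|I|%:R)) => [|k].
  by rewrite divr_ge0 // ltW.
pose curry (g : {ffun 'I_k -> {ffun I -> 'Z_8}}) : {ffun 'I_k * I -> 'Z_8} :=
  [ffun p => g p.1 p.2].
have curry_inj : injective curry.
  move=> g h /ffunP gh; apply/ffunP => j; apply/ffunP => i.
  by have := gh (j, i); rewrite !ffunE.
pose B := [set curry g | g in ffun_on (mem A)].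
have freeB : midpoint_free B.
  move=> _ _ _ /imsetP[g gA ->] /imsetP[h hA ->] /imsetP[l lA ->] /ffunP ghl.
  congr curry; apply/ffunP => j.
  apply: (freeA _ (h j));
    rewrite ?(ffun_onP gA) ?(ffun_onP hA) ?(ffun_onP lA) //.
  by apply/ffunP => i; have := ghl (j, i); rewrite !ffunE.
have := bound _ B freeB.
rewrite card_imset // card_ffun_on card_prod card_ord natrX.
rewrite mulnC exprM expr_div_n ler_pdivrMr ?exprn_gt0 //.
by rewrite natrM mulrA.
Qed.

(** * Concave functions and the binary entropy *)

Section Supergradients.
Variable R : realType.
Implicit Types (f s : R -> R) (a b c K x y : R).

(** The supremum of the points where f is at most c is a solution. *)
Lemma lipschitz_ivt f a b c K : a <= b -> 0 < K ->
  (forall x y, a <= x -> x <= y -> y <= b -> `|f y - f x| <= K * (y - x)) ->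
  f a <= c <= f b -> exists2 x, a <= x <= b & f x = c.
Proof.
move=> ab K0 lip /andP[fac cfb].
pose S := [set x | a <= x <= b /\ f x <= c]%classic.
have Sa : S a by split; rewrite ?lexx.
have supS : has_sup S by split; [exists a | exists b => x [/andP[]]].
have [sup_ub sup_adh] := (sup_upper_bound supS, @sup_adherent _ S).
set s := sup S in sup_ub *.
have as_ : a <= s by exact: sup_ub.
have sb : s <= b by apply: ge_sup; [exists a | move=> x [/andP[]]].
exists s; first by rewrite as_.
apply/eqP; rewrite eq_le; apply/andP; split; rewrite leNgt; apply/negP => fs.
- have e0 : 0 < (f s - c) / K by rewrite divr_gt0 // subr_gt0.
  have [x [/andP[ax xb] fx]] := sup_adh _ e0 supS; rewrite -/s => sx.
  have xs : x <= s by apply: sup_ub; split; rewrite ?ax.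
  have := lip x s ax xs sb; move/(le_trans (ler_norm _)).
  move: sx; rewrite ltrBlDr -ltrBlDl ltr_pdivlMr // mulrC; lra.
- have sb' : s < b.
    rewrite lt_neqAle sb andbT; apply/eqP => sb_.
    by rewrite sb_ ltNge cfb in fs.
  pose t := Num.min b (s + (c - f s) / K).
  have st : s < t by rewrite lt_min sb' ltrDl divr_gt0 // subr_gt0.
  have : t <= s.
    apply: sup_ub; split; first by rewrite ge_min lexx (le_trans as_ (ltW st)).
    have tb : t <= b by rewrite ge_min lexx.
    have := lip s t as_ (ltW st) tb; move/(le_trans (ler_norm _)).
    have : t - s <= (c - f s) / K by rewrite lerBlDl ge_min lexx orbT.
    by rewrite ler_pdivlMr // mulrC; lra.
  by rewrite leNgt st.
Qed.

Definition supergradient f s a b : Prop := forall x y,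
  a <= x <= b -> a <= y <= b -> f y <= f x + s x * (y - x).

(** Supergradients decrease: adding the inequalities at u from v and at v from
    u gives s v <= s u for u < v. *)
Lemma supergradient_bounds f s a b x y : supergradient f s a b ->
  a <= x -> x <= y -> y <= b ->
  s b * (y - x) <= f y - f x <= s a * (y - x).
Proof.
move=> fs ax xy yb.
have anti u v : a <= u -> u <= v -> v <= b -> s v * (y - x) <= s u * (y - x).
  move=> au uv vb; rewrite ler_wpM2r ?subr_ge0 //.
  move: uv; rewrite le_eqVlt => /orP[/eqP->//|uv].
  have uab : a <= u <= b by rewrite au (le_trans (ltW uv)).
  have vab : a <= v <= b by rewrite vb (le_trans au) // ltW.
  have := lerD (fs u v uab vab) (fs v u vab uab) => h.
  have : 0 <= (s u - s v) * (v - u) by lra.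
  by rewrite pmulr_lge0 ?subr_gt0 // subr_ge0.
have xab : a <= x <= b by rewrite ax (le_trans xy).
have yab : a <= y <= b by rewrite yb (le_trans ax).
have := fs x y xab yab; have := fs y x yab xab.
have := anti a x (lexx _) ax (le_trans xy yb).
have := anti y b (le_trans ax xy) yb (lexx _).
by move=> h1 h2 h3 h4; apply/andP; split; lra.
Qed.

Lemma supergradient_lipschitz f s a b : a <= b ->
  supergradient f s a b ->
  exists2 K : R, 0 < K & forall x y, a <= x -> x <= y -> y <= b ->
    `|f y - f x| <= K * (y - x).
Proof.
move=> ab fs; exists (1 + `|s a| + `|s b|) => [|x y ax xy yb].
  by rewrite -addrA ltr_pwDl // addr_ge0.
have /andP[lo hi] := supergradient_bounds fs ax xy yb.
have d0 : 0 <= y - x by rewrite subr_ge0.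
have h1 : s a * (y - x) <= `|s a| * (y - x) by rewrite ler_wpM2r // ler_norm.
have h2 : - s b * (y - x) <= `|s b| * (y - x).
  by rewrite ler_wpM2r // -normrN ler_norm.
have h3 : 0 <= `|s a| * (y - x) by rewrite mulr_ge0.
have h4 : 0 <= `|s b| * (y - x) by rewrite mulr_ge0.
by rewrite ler_norml; apply/andP; split; lra.
Qed.

End Supergradients.

Section Entropy.
Variable R : realType.
Implicit Types p q t x y z : R.

Lemma mul_ln_sub_le p q : 0 <= p -> 0 < q -> p * (ln q - ln p) <= q - p.
Proof.
rewrite le_eqVlt => /orP[/eqP<-|p0] q0; first by rewrite mul0r subr0 ltW.
have -> : q - p = p * (expR (ln q - ln p) - 1).
  rewrite expRD expRN !lnK ?posrE // mulrBr mulr1 mulrCA.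
  by rewrite divff ?gt_eqF // mulr1.
by rewrite ler_pM2l // lerBrDl expR_ge1Dx.
Qed.

Lemma mul_ln_sub_lt p q : 0 <= p -> 0 < q -> q != p ->
  p * (ln q - ln p) < q - p.
Proof.
rewrite le_eqVlt => /orP[/eqP<-|p0] q0 qp; first by rewrite mul0r subr0.
have -> : q - p = p * (expR (ln q - ln p) - 1).
  rewrite expRD expRN !lnK ?posrE // mulrBr mulr1 mulrCA.
  by rewrite divff ?gt_eqF // mulr1.
rewrite ltr_pM2l // ltrBrDl expR_gt1Dx // subr_eq0.
by apply: contraNneq qp => /ln_inj ->.
Qed.

Definition ln_entropy t : R := - t * ln t - (1 - t) * ln (1 - t).

(** Entropy is at most cross-entropy.  Read in q for fixed p, the right side is
    the tangent at p of the concave function ln_entropy. *)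
Lemma gibbs p q : 0 <= q <= 1 -> 0 < p < 1 ->
  ln_entropy q <= - q * ln p - (1 - q) * ln (1 - p).
Proof.
move=> /andP[q0 q1] /andP[p0 p1]; rewrite /ln_entropy.
have := mul_ln_sub_le q0 p0.
have q1' : 0 <= 1 - q by rewrite subr_ge0.
have p1' : 0 < 1 - p by rewrite subr_gt0.
by have := mul_ln_sub_le q1' p1'; lra.
Qed.

Lemma gibbs_lt p q : 0 <= q <= 1 -> 0 < p < 1 -> p != q ->
  ln_entropy q < - q * ln p - (1 - q) * ln (1 - p).
Proof.
move=> /andP[q0 q1] /andP[p0 p1] pq; rewrite /ln_entropy.
have := mul_ln_sub_lt q0 p0 pq.
have q1' : 0 <= 1 - q by rewrite subr_ge0.
have p1' : 0 < 1 - p by rewrite subr_gt0.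
by have := mul_ln_sub_le q1' p1'; lra.
Qed.

Definition logit p : R := ln (1 - p) - ln p.

Lemma ln_entropy_tangent p q : 0 <= q <= 1 -> 0 < p < 1 ->
  ln_entropy q <= ln_entropy p + logit p * (q - p).
Proof.
by move=> q01 p01; have := gibbs q01 p01; rewrite /ln_entropy /logit; lra.
Qed.

Lemma ln_entropy_tangent_lt p q : 0 <= q <= 1 -> 0 < p < 1 -> p != q ->
  ln_entropy q < ln_entropy p + logit p * (q - p).
Proof.
move=> q01 p01 pq; have := gibbs_lt q01 p01 pq.
by rewrite /ln_entropy /logit; lra.
Qed.

Lemma logit_ge0 p : 0 < p <= 2^-1 -> 0 <= logit p.
Proof.
by move=> /andP[p0 p2]; rewrite subr_ge0 ler_ln ?posrE //; lra.
Qed.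

Lemma ln_entropy_lt p q : 0 <= p -> p < q -> q <= 2^-1 ->
  ln_entropy p < ln_entropy q.
Proof.
move=> p0 pq q2.
have /lt_le_trans-> // : ln_entropy p < ln_entropy q + logit q * (p - q).
  by apply: ln_entropy_tangent_lt; rewrite ?gt_eqF //; lra.
rewrite gerDl mulr_ge0_le0 ?subr_le0 ?(ltW pq) //.
by apply: logit_ge0; lra.
Qed.

(** With nats instead of bits, the exponent H2(theta) + H2(1 - 2 theta) of the
    number of elements in fibers at level theta. *)
Definition fiber_entropy t : R := ln_entropy t + ln_entropy (1 - 2 * t).
Definition fiber_slope t : R := logit t - 2 * logit (1 - 2 * t).

Lemma fiber_tangent_lt x y : 0 < x < 2^-1 -> 0 <= y <= 2^-1 -> x != y ->
  fiber_entropy y < fiber_entropy x + fiber_slope x * (y - x).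
Proof.
move=> x01 y01 xy; rewrite /fiber_entropy /fiber_slope.
have : ln_entropy y < ln_entropy x + logit x * (y - x).
  by apply: ln_entropy_tangent_lt => //; lra.
have : ln_entropy (1 - 2 * y) <= ln_entropy (1 - 2 * x)
    + logit (1 - 2 * x) * ((1 - 2 * y) - (1 - 2 * x)).
  by apply: ln_entropy_tangent; lra.
by lra.
Qed.

Lemma fiber_tangent x y : 0 < x < 2^-1 -> 0 <= y <= 2^-1 ->
  fiber_entropy y <= fiber_entropy x + fiber_slope x * (y - x).
Proof.
move=> x2 y2; have [->|xy] := eqVneq x y; first by rewrite subrr mulr0 addr0.
exact/ltW/fiber_tangent_lt.
Qed.

(** The slope at x is nonpositive, because x is to the right of the critical
    point x0, and concavity then gives the decrease from x to y. *)
Lemma fiber_entropy_lt x0 x y : 4^-1 < x0 < 2^-1 -> fiber_slope x0 = 0 ->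
  x0 <= x -> x < y -> y <= 2^-1 -> fiber_entropy y < fiber_entropy x.
Proof.
move=> x02 slope0 x0x xy y2.
have slope : fiber_slope x * (y - x) <= 0.
  have [<-|x0x'] := eqVneq x0 x; first by rewrite slope0 mul0r.
  have lt0 : x0 < x by rewrite lt_neqAle x0x'.
  have t1 : fiber_entropy x0 <= fiber_entropy x + fiber_slope x * (x0 - x).
    by apply: fiber_tangent; lra.
  have t2 : fiber_entropy x <= fiber_entropy x0 + fiber_slope x0 * (x - x0).
    by apply: fiber_tangent; lra.
  rewrite slope0 in t2.
  have : fiber_slope x * (x - x0) <= 0 by lra.
  by rewrite pmulr_lle0 ?subr_gt0 // pmulr_lle0 ?subr_gt0.
have : fiber_entropy y < fiber_entropy x + fiber_slope x * (y - x).
  by apply: fiber_tangent_lt; rewrite ?lt_eqF //; lra.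
by lra.
Qed.

(** The slope vanishes when (1 - x)(1 - 2x)^2 = x (2x)^2, a cubic equation. *)
Lemma fiber_slope_root : exists x0 : R,
  4^-1 < x0 < 31 / 100 /\ fiber_slope x0 = 0.
Proof.
pose p : {poly R} := 8 *: 'X^3 - 8 *: 'X^2 + 5 *: 'X - 1.
have pE x : p.[x] = 8 * x ^+ 3 - 8 * x ^+ 2 + 5 * x - 1.
  by rewrite /p !hornerE.
have [||x /andP[xl xu] /rootP px] := @poly_ivt R p 4^-1 (31 / 100).
- by lra.
- by rewrite !pE; lra.
have xl' : 4^-1 < x.
  by rewrite lt_neqAle xl andbT; apply/eqP => xE; move: px; rewrite -xE pE; lra.
have xu' : x < 31 / 100.
  by rewrite lt_neqAle xu andbT; apply/eqP => xE; move: px; rewrite xE pE; lra.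
exists x; rewrite xl' xu'; split=> //.
rewrite /fiber_slope /logit (_ : 1 - (1 - 2 * x) = 2 * x); last by ring.
have : ln ((1 - x) * (1 - 2 * x) ^+ 2) = ln (x * (2 * x) ^+ 2).
  by congr ln; move: px; rewrite pE; lra.
rewrite !lnM ?lnXn ?posrE ?exprn_gt0 //; try lra.
Qed.

End Entropy.

(** * The quaternary entropy *)

Section QuaternaryEntropy.
Variable R : realType.
Implicit Types x z rho sigma : R.

Definition tetranomial x : R := 1 + x + x ^+ 2 + x ^+ 3.

Definition tilted rho x : R := x `^ (- (3 * rho)) * tetranomial x.

Definition log_tilted rho x : R := ln (tetranomial x) - 3 * rho * ln x.

Definition tilted_inf rho : R :=
  inf [set tilted rho x | x in [set x | 0 < x]]%classic.

Definition ln_H4 rho : R := ln (tilted_inf rho).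

(** The mean of the degree of 1, x, x^2, x^3 under the weights z^i is 3 rho;
    this is the vanishing at z of the derivative of ln (tilted rho). *)
Definition critical rho z : Prop :=
  z + 2 * z ^+ 2 + 3 * z ^+ 3 = 3 * rho * tetranomial z.

Lemma tetranomial_gt0 x : 0 < x -> 0 < tetranomial x.
Proof. by move=> x0; rewrite !addr_gt0 ?exprn_gt0. Qed.

Lemma tilted_gt0 rho x : 0 < x -> 0 < tilted rho x.
Proof. by move=> x0; rewrite mulr_gt0 ?powR_gt0 ?tetranomial_gt0. Qed.

Lemma ln_tilted rho x : 0 < x -> ln (tilted rho x) = log_tilted rho x.
Proof.
move=> x0; rewrite lnM ?posrE ?powR_gt0 ?tetranomial_gt0 // ln_powR.
by rewrite /log_tilted; ring.
Qed.

Lemma tilted_set_nonempty rho :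
  ([set tilted rho x | x in [set x : R | 0 < x]] !=set0)%classic.
Proof. by exists (tilted rho 1); exists 1 => /=. Qed.

(** It is the constant term of the tetranomial that gives the bound for x <= 1,
    and its top term for x > 1. *)
Lemma tilted_ge1 rho x : 0 <= rho <= 1 -> 0 < x -> 1 <= tilted rho x.
Proof.
move=> /andP[r0 r1] x0.
have x2 : 0 < x ^+ 2 by rewrite exprn_gt0.
have x3 : 0 < x ^+ 3 by rewrite exprn_gt0.
have [x1|x1] := leP x 1.
  have p1 : 1 <= x `^ (- (3 * rho)).
    rewrite -[leLHS](powRr0 x); apply: ger_powR; rewrite ?x0 ?x1 //.
    by rewrite oppr_le0 mulr_ge0.
  have g1 : 1 <= tetranomial x by rewrite /tetranomial; lra.
  by rewrite (le_trans p1) // ler_peMr ?powR_ge0.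
have <- : x `^ (- 3) * x ^+ 3 = 1.
  by rewrite powRN -powR_mulrn ?(ltW x0) // mulVf // gt_eqF // powR_gt0.
apply: ler_pM; rewrite ?powR_ge0 ?(ltW x3) //;
  last by rewrite /tetranomial; lra.
by apply: ler_powR; [exact: ltW | lra].
Qed.

Lemma tilted_inf_ge1 rho : 0 <= rho <= 1 -> 1 <= tilted_inf rho.
Proof.
move=> r01; apply: lb_le_inf; first exact: tilted_set_nonempty.
by move=> _ [x /= x0 <-]; exact: tilted_ge1.
Qed.

Lemma ln_H4_le rho x : 0 <= rho <= 1 -> 0 < x -> ln_H4 rho <= log_tilted rho x.
Proof.
move=> r01 x0; rewrite -ln_tilted // ler_ln ?posrE ?tilted_gt0 //.
  apply: ge_inf; last by exists x.
  by exists 0 => _ [y /= y0 <-]; exact/ltW/tilted_gt0.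
by rewrite (lt_le_trans _ (tilted_inf_ge1 r01)).
Qed.

(** Jensen's inequality: with x = z exp(s), the quotient by z^(-3 rho) is the
    sum of z^i exp((i - 3 rho) s), and exp(u) >= 1 + u bounds it from below by
    the tetranomial at z plus s times a quantity that is 0 by criticality. *)
Lemma critical_min rho z x : 0 < z -> critical rho z -> 0 < x ->
  tilted rho z <= tilted rho x.
Proof.
move=> z0 zc x0; pose s := ln x - ln z.
have xE : x = z * expR s.
  by rewrite expRD expRN !lnK ?posrE // mulrCA divff ?gt_eqF // mulr1.
have txE : tilted rho x
    = z `^ (- (3 * rho)) * expR (- (3 * rho) * s) * tetranomial x.
  by congr (_ * _); rewrite /powR !gt_eqF // -expRD /s; congr expR; ring.
clearbody s.
have -> : tilted rho x = z `^ (- (3 * rho)) *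
    (expR (- (3 * rho) * s) + z * expR ((1 - 3 * rho) * s)
     + z ^+ 2 * expR ((2 - 3 * rho) * s) + z ^+ 3 * expR ((3 - 3 * rho) * s)).
  rewrite txE -mulrA; congr (_ * _).
  rewrite (_ : (1 - 3 * rho) * s = - (3 * rho) * s + s); last ring.
  rewrite (_ : (2 - 3 * rho) * s = - (3 * rho) * s + s + s); last ring.
  rewrite (_ : (3 - 3 * rho) * s = - (3 * rho) * s + s + s + s); last ring.
  by rewrite !expRD /tetranomial xE; ring.
rewrite ler_wpM2l ?powR_ge0 //.
have e0 := expR_ge1Dx (- (3 * rho) * s).
have e1 := ler_wpM2l (ltW z0) (expR_ge1Dx ((1 - 3 * rho) * s)).
have e2 := ler_wpM2l (exprn_ge0 2 (ltW z0)) (expR_ge1Dx ((2 - 3 * rho) * s)).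
have e3 := ler_wpM2l (exprn_ge0 3 (ltW z0)) (expR_ge1Dx ((3 - 3 * rho) * s)).
have : (z + 2 * z ^+ 2 + 3 * z ^+ 3) * s = 3 * rho * tetranomial z * s.
  by rewrite zc.
by rewrite /tetranomial in zc *; lra.
Qed.

Lemma tilted_inf_critical rho z : 0 < z -> critical rho z ->
  tilted_inf rho = tilted rho z.
Proof.
move=> z0 zc; apply/eqP; rewrite eq_le; apply/andP; split.
  apply: ge_inf; last by exists z.
  by exists 0 => _ [y /= y0 <-]; exact/ltW/tilted_gt0.
apply: lb_le_inf; first exact: tilted_set_nonempty.
by move=> _ [x /= x0 <-]; exact: critical_min.
Qed.

Lemma ln_H4_critical rho z : 0 < z -> critical rho z ->
  ln_H4 rho = log_tilted rho z.
Proof. by move=> z0 zc; rewrite -ln_tilted // -(tilted_inf_critical z0 zc). Qed.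

(** The polynomial whose root is sought is negative at 0, and nonnegative at 1
    where the mean of the degree is 3/2. *)
Lemma exists_critical rho : 0 < rho <= 2^-1 ->
  exists z, [/\ 0 < z <= 1, critical rho z & rho < 2^-1 -> z < 1].
Proof.
move=> /andP[r0 r2].
pose p : {poly R} := 'X + 2 *: 'X^2 + 3 *: 'X^3
  - (3 * rho) *: (1 + 'X + 'X^2 + 'X^3).
have pE z : p.[z] = z + 2 * z ^+ 2 + 3 * z ^+ 3 - 3 * rho * tetranomial z.
  by rewrite /p /tetranomial !hornerE.
have p01 : p.[0] <= 0 <= p.[1].
  by rewrite !pE /tetranomial !expr0n /= !expr1n; lra.
have [z /andP[z0 z1] /rootP pz] := poly_ivt ler01 p01.
have zc : critical rho z by move: pz; rewrite pE /critical; lra.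
have zn0 : 0 < z.
  rewrite lt_neqAle z0 andbT; apply/eqP => z00; move: zc.
  by rewrite /critical /tetranomial -z00 !expr0n /=; lra.
exists z; split=> //; first by rewrite zn0.
move=> r2'; rewrite lt_neqAle z1 andbT; apply/eqP => z11; move: zc.
by rewrite /critical /tetranomial z11 !expr1n; lra.
Qed.

(** For fixed z, log_tilted is affine in rho, and lies above ln_H4. *)
Lemma ln_H4_tangent rho sigma z : 0 < z -> critical rho z -> 0 <= sigma <= 1 ->
  ln_H4 sigma <= ln_H4 rho + 3 * - ln z * (sigma - rho).
Proof.
move=> z0 zc s01; rewrite (ln_H4_critical z0 zc).
apply: le_trans (ln_H4_le s01 z0) _.
by rewrite /log_tilted; lra.
Qed.

(** The tangent at sigma < 1/2 has positive slope, since its z is less than 1.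
    At sigma = 1/2 the slope is zero and an intermediate point is needed. *)
Lemma ln_H4_lt rho sigma : 0 <= rho -> rho < sigma -> sigma <= 2^-1 ->
  ln_H4 rho < ln_H4 sigma.
Proof.
have strict r s : 0 <= r -> r < s -> s < 2^-1 -> ln_H4 r < ln_H4 s.
  move=> r0 rs s2.
  have [|z [/andP[z0 _] zc /(_ s2) z1]] := @exists_critical s; first by lra.
  have r01 : 0 <= r <= 1 by lra.
  apply: le_lt_trans (ln_H4_tangent z0 zc r01) _.
  have lz : ln z < 0 by apply: ln_lt0; rewrite z0.
  by rewrite gtrDl pmulr_rlt0 ?subr_lt0 // mulr_gt0 // oppr_gt0.
move=> r0 rs; rewrite le_eqVlt => /orP[/eqP s2|]; last exact: strict.
have mid : ln_H4 rho < ln_H4 ((rho + sigma) / 2).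
  by apply: strict; lra.
apply: lt_le_trans mid _.
have [|z [/andP[z0 z1] zc _]] := @exists_critical sigma; first by lra.
have r01 : 0 <= (rho + sigma) / 2 <= 1 by lra.
apply: le_trans (ln_H4_tangent z0 zc r01) _.
rewrite gerDl mulr_ge0_le0 //; last by lra.
by rewrite mulr_ge0 // oppr_ge0 ln_le0.
Qed.

Lemma ln_H4_mono rho sigma : 0 <= rho <= 2^-1 -> 0 <= sigma <= 2^-1 ->
  (ln_H4 rho <= ln_H4 sigma) = (rho <= sigma).
Proof.
move=> /andP[r0 r2] /andP[s0 s2].
have [rs|sr|->] := ltgtP rho sigma; rewrite ?lexx //.
  by rewrite ltW // ln_H4_lt.
by apply/negbTE; rewrite -ltNge ln_H4_lt.
Qed.

(** The rho for which z is critical; it is rational for rational z, so that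
    ln_H4 can be evaluated exactly there. *)
Definition tilted_mean z : R :=
  (z + 2 * z ^+ 2 + 3 * z ^+ 3) / (3 * tetranomial z).

Lemma tilted_mean_critical z : 0 < z -> critical (tilted_mean z) z.
Proof.
move=> z0; have g0 := tetranomial_gt0 z0.
by rewrite /critical /tilted_mean; field; rewrite gt_eqF.
Qed.

End QuaternaryEntropy.

(** * Bounds for logarithms *)

Section LogBounds.
Import topology normedtype derive numFieldNormedType.Exports.
Variable R : realType.
Implicit Types t x : R.

Lemma derive_ge0_le (f df : R -> R) t : 0 <= t ->
  (forall x, 0 <= x <= t -> is_derive x 1 f (df x)) ->
  (forall x, 0 <= x <= t -> 0 <= df x) -> f 0 <= f t.
Proof.
move=> t0 fdf df0.
have [||x] := @MVT_segment R f df 0 t t0.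
- by move=> x; rewrite in_itv /= => /andP[x0 xt]; apply: fdf; rewrite !ltW.
- apply: derivable_within_continuous => x; rewrite in_itv /= => x0t.
  by have := fdf x x0t => -[].
rewrite in_itv /= => x0t fE; rewrite -subr_ge0 fE subr0.
by rewrite mulr_ge0 // df0.
Qed.

(** Partial sum of the series of artanh t = (ln (1 + t) - ln (1 - t)) / 2. *)
Definition atanh5 t : R :=
  t + t ^+ 3 / 3 + t ^+ 5 / 5 + t ^+ 7 / 7 + t ^+ 9 / 9.

Lemma is_derive_atanh x : -1 < x < 1 ->
  is_derive x 1 (fun x => ln (1 + x) - ln (1 - x)) ((1 + x)^-1 + (1 - x)^-1).
Proof.
move=> /andP[x0 x1].
have h1 : 0 < 1 + x by lra.
have h2 : 0 < 1 - x by lra.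
have d1 := is_derive1_ln h1; have d2 := is_derive1_ln h2.
apply: is_derive_eq.
by rewrite !add0r; ring.
Qed.

Lemma is_derive_atanh5 x : is_derive x 1 atanh5
  (1 + x ^+ 2 + x ^+ 4 + x ^+ 6 + x ^+ 8).
Proof.
rewrite /atanh5; apply: is_derive_eq.
by rewrite /GRing.scale /=; field.
Qed.

Lemma atanh5_le t : 0 <= t < 1 -> 2 * atanh5 t <= ln (1 + t) - ln (1 - t).
Proof.
move=> /andP[t0 t1].
rewrite -subr_ge0; pose f x : R := (ln (1 + x) - ln (1 - x)) - 2 * atanh5 x.
have <- : f 0 = 0.
  by rewrite /f /atanh5 !expr0n /= addr0 subr0 ln1; ring.
pose df x : R := (1 + x)^-1 + (1 - x)^-1
  - 2 * (1 + x ^+ 2 + x ^+ 4 + x ^+ 6 + x ^+ 8).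
apply: (@derive_ge0_le f df t t0) => x /andP[x0 xt].
  have d1 : is_derive x 1 (fun x => ln (1 + x) - ln (1 - x))
      ((1 + x)^-1 + (1 - x)^-1) by apply: is_derive_atanh; lra.
  have d2 := is_derive_atanh5 x.
  by apply: is_derive_eq; rewrite /df /GRing.scale /=; ring.
have -> : df x = 2 * x ^+ 10 / ((1 + x) * (1 - x)).
  by rewrite /df; field; apply/andP; split; rewrite ?gt_eqF //; lra.
by rewrite divr_ge0 ?mulr_ge0 ?exprn_ge0 //; lra.
Qed.

(** The derivative of the difference has the sign of 11 (1 - x^2) - 10, hence
    the range of t. *)
Lemma atanh5_ge t : 0 <= t <= 3 / 10 ->
  ln (1 + t) - ln (1 - t) <= 2 * atanh5 t + t ^+ 11 / 5.
Proof.
move=> /andP[t0 t1].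
rewrite -subr_ge0.
pose f x : R := 2 * atanh5 x + x ^+ 11 / 5 - (ln (1 + x) - ln (1 - x)).
have <- : f 0 = 0.
  by rewrite /f /atanh5 !expr0n /= addr0 subr0 ln1; ring.
pose df x : R := 2 * (1 + x ^+ 2 + x ^+ 4 + x ^+ 6 + x ^+ 8)
  + 11 / 5 * x ^+ 10 - ((1 + x)^-1 + (1 - x)^-1).
apply: (@derive_ge0_le f df t t0) => x /andP[x0 xt].
  have d1 : is_derive x 1 (fun x => ln (1 + x) - ln (1 - x))
      ((1 + x)^-1 + (1 - x)^-1) by apply: is_derive_atanh; lra.
  have d2 := is_derive_atanh5 x.
  by apply: is_derive_eq; rewrite /df /GRing.scale /=; lra.
have -> : df x = x ^+ 10 * (11 * (1 - x ^+ 2) - 10) / (5 * ((1 + x) * (1 - x))).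
  by rewrite /df; field; apply/andP; split; rewrite ?gt_eqF //; lra.
have x2 : x ^+ 2 <= (3 / 10) ^+ 2 by apply: lerXn2r; rewrite ?nnegrE; lra.
by rewrite divr_ge0 ?mulr_ge0 ?exprn_ge0 //; lra.
Qed.

Lemma ln_sub_ge t p q c : 0 <= t < 1 -> 0 < q -> q * (1 + t) <= p * (1 - t) ->
  c <= 2 * atanh5 t -> c <= ln p - ln q.
Proof.
move=> t01 q0 pq ct; have [t0 t1] := andP t01.
have t1' : 0 < 1 - t by lra.
have qt : q * ((1 + t) / (1 - t)) <= p by rewrite mulrA ler_pdivrMr.
have qt0 : 0 < q * ((1 + t) / (1 - t)) by rewrite mulr_gt0 // divr_gt0 //; lra.
rewrite lerBrDl; apply: le_trans (_ : ln (q * ((1 + t) / (1 - t))) <= _).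
  rewrite lnM ?posrE //; last by rewrite divr_gt0 //; lra.
  rewrite ln_div ?posrE //; last by lra.
  by rewrite lerD2l (le_trans ct) // atanh5_le.
by rewrite ler_ln ?posrE // (lt_le_trans qt0).
Qed.

Lemma ln_sub_le t p q c : 0 <= t <= 3 / 10 -> 0 < p ->
  p * (1 - t) <= q * (1 + t) -> 2 * atanh5 t + t ^+ 11 / 5 <= c ->
  ln p - ln q <= c.
Proof.
move=> t01 p0 pq ct; have [t0 t1] := andP t01.
have t1' : 0 < 1 - t by lra.
have t2' : 0 < 1 + t by lra.
have q0 : 0 < q by rewrite -(pmulr_lgt0 _ t2') (lt_le_trans _ pq) // mulr_gt0.
have qt : p <= q * ((1 + t) / (1 - t)) by rewrite mulrA ler_pdivlMr.
rewrite lerBlDl; apply: le_trans (_ : _ <= ln (q * ((1 + t) / (1 - t)))) _.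
  by rewrite ler_ln ?posrE // mulr_gt0 // divr_gt0.
rewrite lnM ?posrE //; last by rewrite divr_gt0.
rewrite ln_div ?posrE //.
by rewrite lerD2l (le_trans _ ct) // atanh5_ge.
Qed.

End LogBounds.

(** * Enclosures of some logarithms *)

Section LogTable.
Variable R : realType.
Local Notation ln := (@ln R).
Local Notation dec a b c := (a / 10 ^+ 3 + b / 10 ^+ 6 + c / 10 ^+ 9).

Ltac log_bounds t u :=
  apply/andP; split;
  [apply: (@ln_sub_ge R t) | apply: (@ln_sub_le R u)]; rewrite /atanh5; lra.

(* In each enclosure the two quantities have a ratio below 5/3, so that
   t = (p - q)/(p + q) is below 1/4, and the arguments given to the tactic are
   that t rounded down and up to nine decimals. *)
Lemma ln43_bounds : dec 287 682 70 <= ln 4 - ln 3 <= dec 287 682 73.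
Proof. by log_bounds (dec 142 857 142 : R) (dec 142 857 143 : R). Qed.

Lemma ln32_bounds : dec 405 465 104 <= ln 3 - ln 2 <= dec 405 465 111.
Proof. by log_bounds (dec 200 0 0 : R) (dec 200 0 1 : R). Qed.

Lemma ln_z_bounds : dec 458 822 741 <= ln 1 - ln (371 / 587) <= dec 458 822 759.
Proof. by log_bounds (dec 225 469 728 : R) (dec 225 469 729 : R). Qed.

Lemma ln_1z_bounds :
  dec 203 324 220 <= ln 2 - ln (1 + 371 / 587) <= dec 203 324 223.
Proof. by log_bounds (dec 101 313 320 : R) (dec 101 313 321 : R). Qed.

Lemma ln_1z2_bounds :
  dec 336 85 341 <= ln (1 + (371 / 587) ^+ 2) - ln 1 <= dec 336 85 345.
Proof. by log_bounds (dec 166 478 587 : R) (dec 166 478 588 : R). Qed.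

Lemma ln_w_bounds : dec 344 70 167 <= ln 1 - ln (487 / 687) <= dec 344 70 171.
Proof. by log_bounds (dec 170 357 751 : R) (dec 170 357 752 : R). Qed.

Lemma ln_1w_bounds :
  dec 157 309 471 <= ln 2 - ln (1 + 487 / 687) <= dec 157 309 474.
Proof. by log_bounds (dec 78 492 935 : R) (dec 78 492 936 : R). Qed.

Lemma ln_1w2_bounds :
  dec 407 136 838 <= ln (1 + (487 / 687) ^+ 2) - ln 1 <= dec 407 136 845.
Proof. by log_bounds (dec 200 802 298 : R) (dec 200 802 299 : R). Qed.

Lemma ln_ta_bounds :
  dec 377 708 221 <= ln 2^-1 - ln (207 / 604) <= dec 377 708 226.
Proof. by log_bounds (dec 186 640 471 : R) (dec 186 640 472 : R). Qed.

Lemma ln_1ta_bounds :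
  dec 419 637 910 <= ln 1 - ln (1 - 207 / 604) <= dec 419 637 919.
Proof. by log_bounds (dec 206 793 206 : R) (dec 206 793 207 : R). Qed.

Lemma ln_12ta_bounds :
  dec 463 402 928 <= ln 2^-1 - ln (1 - 2 * (207 / 604)) <= dec 463 402 948.
Proof. by log_bounds (dec 227 642 276 : R) (dec 227 642 277 : R). Qed.

Lemma ln_tb_bounds :
  dec 377 685 541 <= ln 2^-1 - ln (73 / 213) <= dec 377 685 546.
Proof. by log_bounds (dec 186 629 526 : R) (dec 186 629 527 : R). Qed.

Lemma ln_1tb_bounds :
  dec 419 649 735 <= ln 1 - ln (1 - 73 / 213) <= dec 419 649 744.
Proof. by log_bounds (dec 206 798 866 : R) (dec 206 798 867 : R). Qed.

Lemma ln_12tb_bounds :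
  dec 463 452 349 <= ln 2^-1 - ln (1 - 2 * (73 / 213)) <= dec 463 452 369.
Proof. by log_bounds (dec 227 665 706 : R) (dec 227 665 707 : R). Qed.

Lemma ln_up_bounds :
  dec 120 763 251 <= ln 4 - ln ((7 + 8995 / 10 ^+ 5) / 2) <= dec 120 763 254.
Proof. by log_bounds (dec 60 308 350 : R) (dec 60 308 351 : R). Qed.

Lemma ln_lo_bounds :
  dec 120 777 356 <= ln 4 - ln ((7 + 8985 / 10 ^+ 5) / 2) <= dec 120 777 359.
Proof. by log_bounds (dec 60 315 377 : R) (dec 60 315 378 : R). Qed.
End LogTable.

(** * Values of the entropies near the solution *)

Section Bracket.
Variable R : realType.
Local Notation dec a b c := (a / 10 ^+ 3 + b / 10 ^+ 6 + c / 10 ^+ 9).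

(* The solution is theta = 0.3427188, rho = 0.3193802, with minimisers z =
   0.632027 for H4(rho) and w = 0.708882 for H4(1 - 2 rho).  The fractions are
   close to these values and have small denominators; theta_lo and theta_hi
   are within 5e-6 of theta, on either side. *)
Local Notation theta_lo := (207 / 604 : R).
Local Notation theta_hi := (73 / 213 : R).
Local Notation z0 := (371 / 587 : R).
Local Notation w0 := (487 / 687 : R).

Lemma ln_half : ln (2^-1 : R) = - ln 2. Proof. by rewrite lnV ?posrE. Qed.

Lemma ln_four : ln (4 : R) = 2 * ln 2.
Proof. by rewrite (_ : 4 = 2 * 2) ?lnM ?posrE //; ring. Qed.

Lemma ln2_bounds : dec 693 147 174 <= ln (2 : R) <= dec 693 147 184.
Proof.
by have := ln43_bounds R; have := ln32_bounds R; rewrite ln_four; lra.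
Qed.

Lemma ln_tetranomial (x : R) : 0 < x ->
  ln (tetranomial x) = ln (1 + x) + ln (1 + x ^+ 2).
Proof.
move=> x0; rewrite -lnM ?posrE ?addr_gt0 ?exprn_gt0 //.
by congr ln; rewrite /tetranomial; ring.
Qed.

Lemma fiber_entropyE (t : R) : 0 < t -> fiber_entropy t =
  - t * ln t - (1 - t) * ln (1 - t) - (1 - 2 * t) * ln (1 - 2 * t)
  - 2 * t * (ln 2 + ln t).
Proof.
move=> t0; rewrite /fiber_entropy /ln_entropy -lnM ?posrE //.
by rewrite (_ : 1 - (1 - 2 * t) = 2 * t); ring.
Qed.

Lemma ln_entropy_double (t : R) : 0 < t -> ln_entropy (1 - 2 * t) =
  - (1 - 2 * t) * ln (1 - 2 * t) - 2 * t * (ln 2 + ln t).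
Proof.
move=> t0; rewrite /ln_entropy -lnM ?posrE //.
by rewrite (_ : 1 - (1 - 2 * t) = 2 * t); ring.
Qed.

(** At theta_lo, the point rho = 206/645 is below the curve of the first
    equation and, by log_tilted_le_base_lo, above the curve of the second. *)
Lemma log_tilted_le_fiber_lo :
  log_tilted (206 / 645) z0 <= fiber_entropy theta_lo.
Proof.
rewrite /log_tilted ln_tetranomial ?fiber_entropyE; [|lra|lra].
have := ln2_bounds; have := ln_z_bounds R; have := ln_1z_bounds R.
have := ln_1z2_bounds R; have := ln_ta_bounds R; have := ln_1ta_bounds R.
have := ln_12ta_bounds R; rewrite ln1 ln_half; lra.
Qed.

Lemma log_tilted_le_base_lo :
  log_tilted (1 - 2 * (206 / 645)) w0 <= ln 2 + ln_entropy (1 - 2 * theta_lo).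
Proof.
rewrite /log_tilted ln_tetranomial ?ln_entropy_double; [|lra|lra].
have := ln2_bounds; have := ln_w_bounds R; have := ln_1w_bounds R.
have := ln_1w2_bounds R; have := ln_ta_bounds R.
have := ln_12ta_bounds R; rewrite ln1 ln_half; lra.
Qed.

Lemma tilted_mean_z0 : dec 319 380 298 <= tilted_mean z0 <= dec 319 380 299.
Proof.
have g0 : 0 < tetranomial z0 by apply: tetranomial_gt0; lra.
rewrite /tilted_mean ler_pdivlMr ?ler_pdivrMr ?mulr_gt0 // /tetranomial; lra.
Qed.

Lemma tilted_mean_w0 : dec 361 238 0 <= tilted_mean w0 <= dec 361 239 0.
Proof.
have g0 : 0 < tetranomial w0 by apply: tetranomial_gt0; lra.
rewrite /tilted_mean ler_pdivlMr ?ler_pdivrMr ?mulr_gt0 // /tetranomial; lra.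
Qed.

(** At theta_hi, the point rho = tilted_mean z0 is above the curve of the first
    equation and, by base_hi_le_log_tilted, below that of the second. *)
Lemma fiber_hi_le_log_tilted :
  fiber_entropy theta_hi <= log_tilted (tilted_mean z0) z0.
Proof.
rewrite /log_tilted ln_tetranomial ?fiber_entropyE; [|lra|lra].
have lz := ln_z_bounds R; rewrite ln1 in lz.
have := tilted_mean_z0; set m := tilted_mean z0 => mE.
have : 0 <= (m - dec 319 380 298) * - ln z0.
  by rewrite mulr_ge0; lra.
have := ln2_bounds; have := ln_1z_bounds R.
have := ln_1z2_bounds R; have := ln_tb_bounds R; have := ln_1tb_bounds R.
have := ln_12tb_bounds R; rewrite ln1 ln_half; lra.
Qed.

Lemma base_hi_le_log_tilted :
  ln 2 + ln_entropy (1 - 2 * theta_hi) <= log_tilted (tilted_mean w0) w0.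
Proof.
rewrite /log_tilted ln_tetranomial ?ln_entropy_double; [|lra|lra].
have lw := ln_w_bounds R; rewrite ln1 in lw.
have := tilted_mean_w0; set m := tilted_mean w0 => mE.
have : 0 <= (m - dec 361 238 0) * - ln w0.
  by rewrite mulr_ge0; lra.
have := ln2_bounds; have := ln_1w_bounds R.
have := ln_1w2_bounds R; have := ln_tb_bounds R.
have := ln_12tb_bounds R; rewrite ln1 ln_half; lra.
Qed.

(** Since ln_H4 rho lies between the values of fiber_entropy at theta_hi and at
    theta_lo, this inequality and ln_le_fiber_hi locate twice 2^H4(rho). *)
Lemma fiber_lo_le_ln : fiber_entropy theta_lo <= ln ((7 + 8995 / 10 ^+ 5) / 2).
Proof.
rewrite fiber_entropyE; last by lra.
have := ln2_bounds; have := ln_ta_bounds R; have := ln_1ta_bounds R.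
have := ln_12ta_bounds R; have := ln_up_bounds R.
by rewrite ln1 ln_half ln_four; lra.
Qed.

Lemma ln_le_fiber_hi : ln ((7 + 8985 / 10 ^+ 5) / 2) <= fiber_entropy theta_hi.
Proof.
rewrite fiber_entropyE; last by lra.
have := ln2_bounds; have := ln_tb_bounds R; have := ln_1tb_bounds R.
have := ln_12tb_bounds R; have := ln_lo_bounds R.
by rewrite ln1 ln_half ln_four; lra.
Qed.

Lemma fiber_lo_close_hi :
  fiber_entropy theta_lo <= fiber_entropy theta_hi + dec 0 10 0.
Proof.
rewrite !fiber_entropyE; [|lra|lra].
have := ln2_bounds; have := ln_ta_bounds R; have := ln_1ta_bounds R.
have := ln_12ta_bounds R; have := ln_tb_bounds R; have := ln_1tb_bounds R.
by have := ln_12tb_bounds R; rewrite ln1 ln_half; lra.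
Qed.

Lemma log_tilted_coarse : log_tilted (63 / 200) z0 <= fiber_entropy theta_hi.
Proof.
rewrite /log_tilted ln_tetranomial ?fiber_entropyE; [|lra|lra].
have := ln2_bounds; have := ln_z_bounds R; have := ln_1z_bounds R.
have := ln_1z2_bounds R; have := ln_tb_bounds R; have := ln_1tb_bounds R.
have := ln_12tb_bounds R; rewrite ln1 ln_half; lra.
Qed.

End Bracket.

(** * The solution of the system *)

Section System.
Variable R : realType.
Implicit Types x y theta rho sigma : R.

(** The first equation makes rho decrease as theta increases, and the second
    makes it increase. *)
Lemma system_unique x0 theta rho theta' rho' :
  4^-1 < x0 < 2^-1 -> fiber_slope x0 = 0 ->
  x0 <= theta <= 2^-1 -> x0 <= theta' <= 2^-1 ->
  4^-1 <= rho <= 2^-1 -> 4^-1 <= rho' <= 2^-1 ->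
  ln_H4 rho = fiber_entropy theta -> ln_H4 rho' = fiber_entropy theta' ->
  ln_H4 (1 - 2 * rho) = ln 2 + ln_entropy (1 - 2 * theta) ->
  ln_H4 (1 - 2 * rho') = ln 2 + ln_entropy (1 - 2 * theta') ->
  theta = theta' /\ rho = rho'.
Proof.
move=> x02 slope0.
have no_lt t r t' r' : x0 <= t <= 2^-1 -> x0 <= t' <= 2^-1 ->
    4^-1 <= r <= 2^-1 -> 4^-1 <= r' <= 2^-1 ->
    ln_H4 r = fiber_entropy t -> ln_H4 r' = fiber_entropy t' ->
    ln_H4 (1 - 2 * r) = ln 2 + ln_entropy (1 - 2 * t) ->
    ln_H4 (1 - 2 * r') = ln 2 + ln_entropy (1 - 2 * t') -> ~ t < t'.
  move=> /andP[xt t2] /andP[xt' t2'] r2 r2' e1 e1' e2 e2' tt'.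
  have : ln_H4 r' < ln_H4 r by rewrite e1 e1' (fiber_entropy_lt x02).
  have [rB rB'] : 0 <= r <= 2^-1 /\ 0 <= r' <= 2^-1.
    by clear -r2 r2'; split; lra.
  have [sB sB'] : 0 <= 1 - 2 * r <= 2^-1 /\ 0 <= 1 - 2 * r' <= 2^-1.
    by clear -r2 r2'; split; lra.
  rewrite ltNge ln_H4_mono // -ltNge => rr'.
  have : ln_H4 (1 - 2 * r') < ln_H4 (1 - 2 * r).
    rewrite e2 e2' ltrD2l; clear -x02 xt t2' tt'.
    by apply: ln_entropy_lt; lra.
  rewrite ltNge ln_H4_mono // => /negP; apply; clear -rr'; lra.
move=> t2 t2' r2 r2' e1 e1' e2 e2'.
have tt' : theta = theta'.
  apply/eqP; rewrite eq_le !leNgt; apply/andP; split; apply/negP.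
    exact: (no_lt theta' rho' theta rho).
  exact: (no_lt theta rho theta' rho').
have [rB rB'] : 0 <= rho <= 2^-1 /\ 0 <= rho' <= 2^-1.
  by clear -r2 r2'; split; lra.
split=> //; apply/eqP; rewrite eq_le -(ln_H4_mono rB rB') -(ln_H4_mono rB' rB).
by rewrite e1 e1' tt' lexx.
Qed.

Lemma ln_H4_supergradient : exists s : R -> R,
  (forall rho, 0 < rho < 2^-1 -> 0 < s rho) /\
  (forall a b, 0 < a -> b < 2^-1 -> supergradient (@ln_H4 R) s a b).
Proof.
have /choice[zf zP] : forall rho, exists z : R, 0 < rho < 2^-1 ->
    [/\ 0 < z, z < 1 & critical rho z].
  move=> rho; have [r2|r2] := boolP (0 < rho < 2^-1); last by exists 0.
  have [|z [/andP[z0 z1] zc z1']] := @exists_critical R rho; first by lra.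
  by exists z => _; split=> //; apply: z1'; lra.
exists (fun rho => 3 * - ln (zf rho)); split=> [rho|a b a0 b2 x y ax ay].
  move=> /zP[z0 z1 _].
  by rewrite mulr_gt0 // oppr_gt0 ln_lt0 // z0.
have [|z0 z1 zc] := zP x; first by lra.
by apply: ln_H4_tangent => //; lra.
Qed.

(** Along the curve rho = r(theta) of the first equation, which decreases, the
    difference of the two sides of the second equation is Lipschitz: ln_H4 has
    slope bounded away from 0 on [rl, rh], so that r is Lipschitz.  The points
    ra and rb give its sign at tl and at th. *)
Lemma system_crossing (x0 tl th rl rh ra rb : R) :
  4^-1 < x0 < 2^-1 -> fiber_slope x0 = 0 ->
  x0 <= tl -> tl <= th -> th < 2^-1 -> 4^-1 < rl -> rl <= rh -> rh < 2^-1 ->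
  ln_H4 rl <= fiber_entropy th -> fiber_entropy tl <= ln_H4 rh ->
  4^-1 <= ra <= 2^-1 -> ln_H4 ra <= fiber_entropy tl ->
  ln_H4 (1 - 2 * ra) <= ln 2 + ln_entropy (1 - 2 * tl) ->
  4^-1 <= rb <= 2^-1 -> fiber_entropy th <= ln_H4 rb ->
  ln 2 + ln_entropy (1 - 2 * th) <= ln_H4 (1 - 2 * rb) ->
  exists theta rho, [/\ tl <= theta <= th, rl <= rho <= rh,
    ln_H4 rho = fiber_entropy theta &
    ln_H4 (1 - 2 * rho) = ln 2 + ln_entropy (1 - 2 * theta)].
Proof.
move=> x0B slope0 x0tl tlohi th2 rl4 rlohi rh2 rl_below rh_above raB ra1 ra2.
move=> rbB rb1 rb2; have [x4 x2] := andP x0B.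
have rl0 : 0 < rl by apply: lt_trans rl4; rewrite invr_gt0.
have raB' : 0 <= ra <= 2^-1 by clear -raB; lra.
have rbB' : 0 <= rb <= 2^-1 by clear -rbB; lra.
have tl0 : 4^-1 < tl by exact: lt_le_trans x0tl.
have [s [s0 sP]] := ln_H4_supergradient.
have fib_le x y : tl <= x -> x <= y -> y <= th ->
    fiber_entropy y <= fiber_entropy x.
  move=> lx xy yh; have [->|xy'] := eqVneq x y; first exact: lexx.
  apply/ltW/(fiber_entropy_lt x0B slope0); rewrite ?lt_neqAle ?xy' //.
    exact: le_trans x0tl lx.
  exact: le_trans yh (ltW th2).
have H4sg : supergradient (@ln_H4 R) s rl rh by apply: sP.
have H4sg' : supergradient (@ln_H4 R) s (1 - 2 * rh) (1 - 2 * rl).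
  by apply: sP; [clear -rh2 | clear -rl4]; lra.
have fibsg : supergradient (@fiber_entropy R) (@fiber_slope R) tl th.
  by move=> x y xB yB; apply: fiber_tangent; clear -xB yB tl0 th2; lra.
have basesg : supergradient (fun t : R => ln_entropy (1 - 2 * t))
    (fun t => - 2 * logit (1 - 2 * t)) tl th.
  move=> x y xB yB; have : ln_entropy (1 - 2 * y) <= ln_entropy (1 - 2 * x)
      + logit (1 - 2 * x) * ((1 - 2 * y) - (1 - 2 * x)).
    by apply: ln_entropy_tangent; clear -xB yB tl0 th2; lra.
  move=> /le_trans; apply; rewrite le_eqVlt; apply/orP; left.
  by apply/eqP; ring.
have [K1 K1_gt0 lip1] := supergradient_lipschitz rlohi H4sg.
have [|K2 K2_gt0 lip2] := supergradient_lipschitz _ H4sg';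
  first by clear -rlohi; lra.
have [K3 K3_gt0 lip3] := supergradient_lipschitz tlohi fibsg.
have [K4 K4_gt0 lip4] := supergradient_lipschitz tlohi basesg.
have /choice[r rP] : forall theta, exists rho, tl <= theta <= th ->
    rl <= rho <= rh /\ ln_H4 rho = fiber_entropy theta.
  move=> theta.
  have [tB|tB] := boolP (tl <= theta <= th); last by exists 0.
  have [tlt tht] := andP tB.
  have [|rho rB rE] :=
    lipschitz_ivt rlohi K1_gt0 lip1 (c := fiber_entropy theta).
  - apply/andP; split.
      exact: le_trans rl_below (fib_le _ _ tlt tht (lexx _)).
    exact: le_trans (fib_le _ _ (lexx _) tlt tht) rh_above.
  - by exists rho.
pose Phi theta := ln_H4 (1 - 2 * r theta) - ln_entropy (1 - 2 * theta).
have shi : 0 < s rh by apply: s0; rewrite rh2 (lt_le_trans rl0).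
pose K := K2 * (2 * (K3 / s rh)) + K4.
have K_gt0 : 0 < K.
  by rewrite addr_gt0 // mulr_gt0 // mulr_gt0 // divr_gt0.
have lipPhi x y : tl <= x -> x <= y -> y <= th ->
    `|Phi y - Phi x| <= K * (y - x).
  move=> lx xy yh.
  have [|rxB rxE] := rP x; first by rewrite lx (le_trans xy).
  have [|ryB ryE] := rP y; first by rewrite yh (le_trans lx).
  have ryx : r y <= r x.
    by rewrite -ln_H4_mono ?rxE ?ryE ?fib_le //; clear -rxB ryB rl0 rh2; lra.
  have dr : r x - r y <= K3 / s rh * (y - x).
    have [ryl _] := andP ryB; have [_ rxh] := andP rxB.
    have /andP[lo _] := supergradient_bounds H4sg ryl ryx rxh.
    have := lip3 x y lx xy yh; rewrite distrC -rxE -ryE.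
    move/(le_trans (ler_norm _))/(le_trans lo).
    by rewrite mulrAC ler_pdivlMr // mulrC.
  have d2 : `|ln_H4 (1 - 2 * r y) - ln_H4 (1 - 2 * r x)|
      <= K2 * (2 * (r x - r y)).
    apply: le_trans (lip2 (1 - 2 * r x) (1 - 2 * r y) _ _ _) _.
    - by clear -rxB; lra.
    - by clear -ryx; lra.
    - by clear -ryB; lra.
    by rewrite ler_pM2l //; clear; lra.
  have d4 := lip4 x y lx xy yh.
  have -> : Phi y - Phi x = (ln_H4 (1 - 2 * r y) - ln_H4 (1 - 2 * r x))
     - (ln_entropy (1 - 2 * y) - ln_entropy (1 - 2 * x)) by rewrite /Phi; ring.
  apply: le_trans (ler_normB _ _) _; rewrite [K * _]mulrDl; apply: lerD d4.
  apply: le_trans d2 _; rewrite -mulrA ler_pM2l // -mulrA ler_pM2l //.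
have [|theta tB tE] := lipschitz_ivt tlohi K_gt0 lipPhi (c := ln 2).
  have [|rlB rlE] := rP tl; first by rewrite lexx.
  have [|rhB rhE] := rP th; first by rewrite lexx andbT.
  have rlB' : 0 <= r tl <= 2^-1 by clear -rlB rl0 rh2; lra.
  have rhB' : 0 <= r th <= 2^-1 by clear -rhB rl0 rh2; lra.
  apply/andP; split; rewrite /Phi.
    have ral : ra <= r tl by rewrite -(ln_H4_mono raB' rlB') rlE.
    rewrite lerBlDr; apply: le_trans ra2.
    by rewrite ln_H4_mono; clear -ral rlB raB rl4 rh2; lra.
  have rbh : r th <= rb by rewrite -(ln_H4_mono rhB' rbB') rhE.
  rewrite lerBrDr; apply: le_trans rb2 _.
  by rewrite ln_H4_mono; clear -rbh rhB rbB rl4 rh2; lra.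
have [rB rE] := rP theta tB.
by exists theta, (r theta); split=> //; rewrite -tE /Phi; ring.
Qed.

Local Notation theta_lo := (207 / 604 : R).
Local Notation theta_hi := (73 / 213 : R).
Local Notation rho_lo := (63 / 200 : R).
Local Notation rho_hi := (tilted_mean (16 / 25) : R).

Lemma rho_hi_bounds : 323 / 1000 <= rho_hi <= 324 / 1000.
Proof.
have g0 : 0 < tetranomial (16 / 25 : R) by apply: tetranomial_gt0; lra.
rewrite /tilted_mean ler_pdivlMr ?ler_pdivrMr ?mulr_gt0 // /tetranomial; lra.
Qed.

(** The tangent of ln_H4 at rho_hi has slope at least 3 (9/25), and this lifts
    the value at rho_hi above the one at tilted_mean (371/587) by far more
    than the variation of fiber_entropy on [theta_lo, theta_hi]. *)
Lemma fiber_lo_le_rho_hi : fiber_entropy theta_lo <= ln_H4 rho_hi.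
Proof.
have hi := rho_hi_bounds; have mz := tilted_mean_z0 R.
have z16 : 0 < 16 / 25 :> R by lra.
have zc := tilted_mean_critical z16.
have z0 : 0 < 371 / 587 :> R by lra.
have m01 : 0 <= tilted_mean (371 / 587 : R) <= 1 by lra.
have := ln_H4_tangent z16 zc m01.
rewrite (ln_H4_critical z0 (tilted_mean_critical z0)).
have := fiber_hi_le_log_tilted R; have := fiber_lo_close_hi R.
have l16 : 9 / 25 <= - ln (16 / 25 : R).
  have : ln (1 + - (9 / 25)) <= - (9 / 25) :> R by apply: le_ln1Dx; lra.
  by rewrite (_ : 1 + - (9 / 25) = 16 / 25 :> R); lra.
have : 0 <= (- ln (16 / 25) - 9 / 25) * (rho_hi - tilted_mean (371 / 587)).
  by rewrite mulr_ge0 // subr_ge0 //; lra.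
by lra.
Qed.

Lemma system_solution (x0 : R) : 4^-1 < x0 < 31 / 100 -> fiber_slope x0 = 0 ->
  exists theta rho,
  [/\ theta_lo <= theta <= theta_hi, rho_lo <= rho <= rho_hi,
      ln_H4 rho = fiber_entropy theta &
      ln_H4 (1 - 2 * rho) = ln 2 + ln_entropy (1 - 2 * theta)].
Proof.
move=> /andP[x4 x3] slope0.
have hiB := rho_hi_bounds.
have z0 : 0 < 371 / 587 :> R by clear; lra.
have w0 : 0 < 487 / 687 :> R by clear; lra.
have mz : 319 / 1000 <= tilted_mean (371 / 587 : R) <= 320 / 1000.
  by have := tilted_mean_z0 R; clear; lra.
have mwz : 4^-1 <= tilted_mean (487 / 687 : R)
    <= 1 - 2 * tilted_mean (371 / 587).
  by have := tilted_mean_z0 R; have := tilted_mean_w0 R; clear; lra.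
apply: (@system_crossing x0 theta_lo theta_hi rho_lo rho_hi (206 / 645)
  (tilted_mean (371 / 587))).
- by clear -x4 x3; lra.
- by [].
- by clear -x3; lra.
- by clear; lra.
- by clear; lra.
- by clear; lra.
- by clear -hiB; lra.
- by clear -hiB; lra.
- apply: le_trans (log_tilted_coarse R).
  by apply: ln_H4_le => //; clear; lra.
- exact: fiber_lo_le_rho_hi.
- by clear; lra.
- apply: le_trans (log_tilted_le_fiber_lo R).
  by apply: ln_H4_le => //; clear; lra.
- apply: le_trans (log_tilted_le_base_lo R).
  by apply: ln_H4_le => //; clear; lra.
- by clear -mz; lra.
- rewrite (ln_H4_critical z0 (tilted_mean_critical z0)).
  exact: fiber_hi_le_log_tilted.
- apply: le_trans (base_hi_le_log_tilted R) _.
  rewrite -(ln_H4_critical w0 (tilted_mean_critical w0)) ln_H4_mono.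
  + by case/andP: mwz.
  + by clear -mwz mz; lra.
  + by clear -mz; lra.
Qed.

End System.

(** * The bound for powers of the cyclic group of order 8 *)

Lemma progression_free_midpoint (n : nat) (A : {set C8_power n}) :
  progression_free A -> exists2 B : {set {ffun 'I_n -> 'Z_8}},
    midpoint_free B & #|B| = #|A|.
Proof.
move=> /forall_inP freeA.
pose B : {set {ffun 'I_n -> 'Z_8}} := [set (a : {ffun 'I_n -> 'Z_8}) | a in A].
exists B; last by rewrite card_imset.
move=> _ _ _ /imsetP[a aA ->] /imsetP[b bA ->] /imsetP[c cA ->] abc.
apply/eqP/negPn/negP => ac.
have /forall_inP/(_ c cA) := forall_inP (freeA a aA) b bA.
case/negP; apply/and4P; split => //.
- apply/negP => /eqP ab; case/negP: ac; apply/eqP.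
  by move: abc; rewrite -ab => /addrI ->.
- apply/negP => /eqP bc; case/negP: ac; apply/eqP.
  by move: abc; rewrite -bc => /addIr ->.
- apply/eqP; rewrite expgS expg1; apply/ffunP => i; rewrite !ffunE.
  by move/ffunP: abc => /(_ i); rewrite !ffunE.
Qed.

(** The odds p/(1 - p) are the minimiser of x^(-p) (1 + x). *)
Lemma odds_entropy (R : realType) (p : R) : 0 < p < 1 ->
  (p / (1 - p)) `^ (- p) * (1 + p / (1 - p)) = expR (ln_entropy p).
Proof.
move=> /andP[p0 p1]; have q0 : 0 < 1 - p by rewrite subr_gt0.
have -> : 1 + p / (1 - p) = expR (- ln (1 - p)).
  by rewrite expRN lnK ?posrE //; field; rewrite gt_eqF.
rewrite /powR gt_eqF ?divr_gt0 // -expRD; congr expR; rewrite ln_div ?posrE //.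
by rewrite /ln_entropy; ring.
Qed.

(** With the optimal x, y, z, w for theta, 1 - 2 theta, rho, 1 - 2 rho, the
    first equation of the system says c1 c2 = L and the second that the fourth
    exponential rate is 2 c2. *)
Lemma card_midpoint_free_le_expR (R : realType) (theta rho : R) (I : finType)
    (A : {set {ffun I -> 'Z_8}}) :
  31 / 100 <= theta < 2^-1 -> 4^-1 <= rho < 2^-1 ->
  ln_H4 rho = fiber_entropy theta ->
  ln_H4 (1 - 2 * rho) = ln 2 + ln_entropy (1 - 2 * theta) ->
  midpoint_free A -> #|A|%:R <= (2 * expR (ln_H4 rho)) ^+ #|I|.
Proof.
move=> /andP[t3 t2] /andP[r4 r2] eq1 eq2 freeA.
have t0 : 0 < theta by clear -t3; lra.
have t1 : 0 < 1 - theta by clear -t2; lra.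
have p0 : 0 < 1 - 2 * theta by clear -t2; lra.
have [|z [z01 zc _]] := @exists_critical R rho; first by clear -r4 r2; lra.
have [|w [w01 wc _]] := @exists_critical R (1 - 2 * rho).
  by clear -r4 r2; lra.
have [[z0 _] [w0 _]] := (andP z01, andP w01).
have tiltedE (sigma v : R) : 0 < v -> critical sigma v ->
    tilted sigma v = expR (ln_H4 sigma).
  move=> v0 vc; rewrite (ln_H4_critical v0 vc) -ln_tilted // lnK //.
  by rewrite posrE tilted_gt0.
apply: (tensor_power (a := 6) (b := 2)) => //.
  by rewrite mulr_gt0 ?expR_gt0.
move=> J B freeB.
pose p := 1 - 2 * theta.
have pE : 1 - p = 2 * theta by rewrite /p; ring.
apply: (@card_midpoint_free_le R J B theta rho (theta / (1 - theta))
  (p / (1 - p)) z w) => //.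
- exact: ltW.
- by rewrite divr_gt0 //= ler_pdivrMr //; clear -t2; lra.
- rewrite pE divr_gt0 //= ?ler_pdivrMr ?mulr_gt0 //.
  by rewrite /p; clear -t3; lra.
- rewrite pE expr_div_n ler_pdivrMr ?exprn_gt0 ?mulr_gt0 //.
  rewrite mulrAC ler_pdivlMr // /p -subr_ge0.
  (* y^2 <= x amounts to 8 theta^3 - 8 theta^2 + 5 theta - 1 >= 0; eight times
     the product below accounts for all but an affine function of theta. *)
  have : 0 <= (theta - 31 / 100) * ((theta - 69 / 200) ^+ 2 + 1 / 4).
    by rewrite mulr_ge0 ?subr_ge0 // addr_ge0 ?sqr_ge0 // divr_ge0.
  by clear -t3; lra.
- rewrite odds_entropy; last by rewrite t0 -subr_gt0.
  rewrite -/p odds_entropy; last by rewrite p0 -subr_gt0 pE mulr_gt0.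
  by rewrite -expRD eq1 lexx.
- by rewrite -(tiltedE _ _ z0 zc) lexx.
- rewrite -/p odds_entropy; last by rewrite p0 -subr_gt0 pE mulr_gt0.
  by rewrite -[leLHS]/(tilted (1 - 2 * rho) w) tiltedE // eq2 expRD lnK ?posrE.
Qed.

Theorem theorem1p1 (R : realType) :
  exists x0 theta1 rho0 : R,
    unique (maximum_point (fun x => H2 (1 - 2 * x) + H2 x) 4^-1 2^-1) x0 /\
    unique (entropy_system x0) (theta1, rho0) /\
    `|rho0 - 32 / 100| <= 5 / 10 ^+ 3 /\
    (forall (n : nat) (A : {set C8_power n}),
       (0 < n)%N -> progression_free A ->
       #|A|%:R <= (2 * 2 `^ H4 rho0) ^+ n) /\
    `|2 * 2 `^ H4 rho0 - (7 + 899 / 10 ^+ 4)| <= 5 / 10 ^+ 5 /\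
    (forall n : nat, (0 < n)%N ->
       (r3 (C8_power n))%:R <= (709 / 100 : R) ^+ n).
Proof.
have [x0 [x0B slope0]] := @fiber_slope_root R.
have [theta [rho [thetaB rhoB eq1 eq2]]] := system_solution x0B slope0.
have l2 : 0 < ln 2 :> R by rewrite ln_gt0 // ltr1n.
have hiB := @rho_hi_bounds R.
have H2E (t : R) : H2 t = ln_entropy t / ln 2.
  by rewrite /H2 /log2 /ln_entropy; field; rewrite gt_eqF.
have H4E (r : R) : H4 r = ln_H4 r / ln 2 by [].
have fibE (t : R) : H2 (1 - 2 * t) + H2 t = fiber_entropy t / ln 2.
  by rewrite !H2E -mulrDl addrC.
have lambdaE : 2 `^ H4 rho = expR (ln_H4 rho).
  by rewrite /powR gt_eqF // H4E divfK ?gt_eqF.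
have x02 : 4^-1 < x0 < 2^-1 by clear -x0B; lra.
have thetaB' : x0 <= theta <= 2^-1 by clear -x0B thetaB; lra.
have rhoB' : 4^-1 <= rho <= 2^-1 by clear -hiB rhoB; lra.
have bound (n : nat) (A : {set C8_power n}) : progression_free A ->
    #|A|%:R <= (2 * 2 `^ H4 rho) ^+ n.
  move=> /progression_free_midpoint[B freeB <-].
  rewrite lambdaE -[X in _ ^+ X]card_ord.
  apply: (card_midpoint_free_le_expR _ _ eq1 eq2 freeB).
    by clear -thetaB; lra.
  by clear -hiB rhoB; lra.
have lambdaB : 7 + 8985 / 10 ^+ 5 <= 2 * 2 `^ H4 rho <= 7 + 8995 / 10 ^+ 5.
  have [tl th] := andP thetaB; have [xl xh] := andP thetaB'.
  have fib_le (x y : R) : x0 <= x -> x <= y -> y <= 2^-1 ->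
      fiber_entropy y <= fiber_entropy x.
    move=> x0x xy y2; have [->|xy'] := eqVneq x y; first exact: lexx.
    by apply/ltW/(fiber_entropy_lt x02 slope0); rewrite ?lt_neqAle ?xy'.
  rewrite lambdaE eq1 ![2 * _]mulrC; apply/andP; split.
    rewrite -ler_pdivrMr // -[leLHS]lnK ?posrE; last by clear; lra.
    rewrite ler_expR; apply: le_trans (ln_le_fiber_hi R) _.
    by apply: fib_le => //; clear; lra.
  rewrite -ler_pdivlMr // -[leRHS]lnK ?posrE; last by clear; lra.
  rewrite ler_expR; apply: le_trans (fiber_lo_le_ln R).
  by apply: fib_le => //; clear -x0B; lra.
exists x0, theta, rho; split; last split; last split; last split; last split.
- split; first split.
  + by clear -x02; lra.
  + move=> y yB; rewrite !fibE ler_pM2r ?invr_gt0 //.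
    have : fiber_entropy y <= fiber_entropy x0 + fiber_slope x0 * (y - x0).
      by apply: fiber_tangent; [clear -x02 | clear -yB]; lra.
    by rewrite slope0 mul0r addr0.
  + move=> y [yB ymax]; apply/eqP; apply: contraT => x0y.
    have x0B' : 4^-1 <= x0 <= 2^-1 by clear -x02; lra.
    have := ymax x0 x0B'; rewrite !fibE ler_pM2r ?invr_gt0 // leNgt.
    have : fiber_entropy y < fiber_entropy x0 + fiber_slope x0 * (y - x0).
      by apply: fiber_tangent_lt => //; [clear -x02 | clear -yB]; lra.
    by rewrite slope0 mul0r addr0 => ->.
- have sysE (t r : R) : entropy_system x0 (t, r) <->
      [/\ x0 <= t <= 2^-1, 4^-1 <= r <= 2^-1, ln_H4 r = fiber_entropy t &
          ln_H4 (1 - 2 * r) = ln 2 + ln_entropy (1 - 2 * t)].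
    have e1 : H4 r = H2 t + H2 (1 - 2 * t) <-> ln_H4 r = fiber_entropy t.
      rewrite addrC fibE H4E; split=> [|-> //].
      by move/(congr1 (fun u => u * ln 2)); rewrite !divfK ?gt_eqF.
    have e2 : H4 (1 - 2 * r) = 1 + H2 (1 - 2 * t) <->
        ln_H4 (1 - 2 * r) = ln 2 + ln_entropy (1 - 2 * t).
      have -> : 1 + H2 (1 - 2 * t) = (ln 2 + ln_entropy (1 - 2 * t)) / ln 2.
        by rewrite H2E [RHS]mulrDl divff ?gt_eqF.
      rewrite H4E; split=> [|-> //].
      by move/(congr1 (fun u => u * ln 2)); rewrite !divfK ?gt_eqF.
    by split=> -[? ? /e1 ? /e2 ?].
  split; first exact/sysE.
  move=> [t r] /sysE[tB rB f1 f2].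
  have [-> ->] // := system_unique x02 slope0 thetaB' tB rhoB' rB eq1 f1 eq2 f2.
- by rewrite ler_norml; clear -hiB rhoB; apply/andP; split; lra.
- by move=> n A _; exact: bound.
- by rewrite ler_norml; clear -lambdaB; apply/andP; split; lra.
- move=> n _; apply: (@le_trans _ _ ((2 * 2 `^ H4 rho) ^+ n)).
    rewrite /r3; apply: (big_ind (fun m => m%:R <= (2 * 2 `^ H4 rho) ^+ n)).
    + by rewrite exprn_ge0 // mulr_ge0 ?powR_ge0.
    + by move=> k m kB mB; case: (leqP k m) => _.
    + by move=> A; exact: bound.
  apply: lerXn2r; rewrite ?nnegrE ?mulr_ge0 ?powR_ge0 //; clear -lambdaB; lra.
Qed.
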